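(* Let $\alpha(n)$ be defined as below. Then, as $n\to\infty$, $$\alpha(n)\le n^{5/6+o(1)},$$ i.e., for every $\delta>0$ we have $\alpha(n)\le n^{5/6+\delta}$ for all sufficiently large $n$. Equivalently, there are $n$-point sets in the plane with no four points on a line in which every subset of size $n^{5/6+o(1)}$ contains three collinear points.
   Context: A finite set of points in $\mathbb{R}^2$ is in general position if no three of its points lie on a common line. For a finite set $S\subset\mathbb{R}^2$, let $\alpha(S)$ denote the maximum size of a subset of $S$ in general position. Define $$\alpha(n)=\min\{\alpha(S): S\subset\mathbb{R}^2,\ |S|=n,\ \text{no four points of } S \text{ lie on a common line}\}.$$ *)

(* Defs.v *)
From Stdlib Require Import Reals List.
Import ListNotations.
Open Scope R_scope.

Definition point : Type := (R * R)%type.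

Definition on_line (a b c : R) (p : point) : Prop :=
  a * fst p + b * snd p = c.

Definition is_line (a b c : R) : Prop := ~ (a = 0 /\ b = 0).

Definition finite_set (S : list point) : Prop := NoDup S.

Definition subset_of (T S : list point) : Prop := NoDup T /\ incl T S.

Definition general_position (S : list point) : Prop :=
  forall p q r : point, In p S -> In q S -> In r S ->
    p <> q -> p <> r -> q <> r ->
    ~ (exists a b c : R, is_line a b c /\
         on_line a b c p /\ on_line a b c q /\ on_line a b c r).

Definition no_four_on_a_line (S : list point) : Prop :=
  forall p q r s : point, In p S -> In q S -> In r S -> In s S ->
    p <> q -> p <> r -> p <> s -> q <> r -> q <> s -> r <> s ->
    ~ (exists a b c : R, is_line a b c /\
         on_line a b c p /\ on_line a b c q /\ on_line a b c r /\ on_line a b c s).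

Definition alpha_le (S : list point) (k : R) : Prop :=
  forall T : list point, subset_of T S -> general_position T -> INR (length T) <= k.

(* Main.v *)
Require Import Defs.
From Stdlib Require Import Reals List.
From Stdlib Require Import Lra Lia ZArith FinFun.
From mathcomp Require all_boot zify.
Open Scope R_scope.

(** Following Balogh and Solymosi, the points are a random subset of the grid [n]^3, n = b^(3u),
    pushed to the plane by a linear map that preserves and reflects collinearity.

    Supersaturation: in a set A of a points of the grid with a >= 12 k n^2, every direction v with
    entries in [1, k] meets at most 3 k n^2 lines, so at least a/6 disjoint triples of A lie on
    lines of direction v. Taking all primitive v gives a linear 3-uniform hypergraph on A with
    D >= k^3/2 directions, degrees at most D and at least D a/6 edges.

    Containers: for such a hypergraph, asking successively whether a vertex of large degree belongs
    to an independent set I, one collects either many vertices outside I, or about a/sqrt(D)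
    vertices of I whose link graph has bounded degree; the same search in that graph then removes a
    fixed proportion of A. The sets at the leaves of this decision tree cover all independent sets.
    Iterating leaves exp(n^(5/3+o(1))) containers of size n^(8/3+o(1)), which bounds the number of
    m-subsets in general position for m = n^(5/3+o(1)).

    A random subset of density n^(-1-o(1)) then contains, in expectation, few of the n^(6+o(1))
    collinear quadruples and no m-subset in general position. Deleting a point from each quadruple
    leaves n^(2-o(1)) points. All n^(o(1)) factors are powers of b, with u large. *)

(** * Plane geometry and asymptotics *)

Definition zero_det (p q r : point) : Prop :=
  (fst q - fst p) * (snd r - snd p) = (snd q - snd p) * (fst r - fst p).

(** The normal (a, b) is orthogonal to both difference vectors, so a nonzero determinant would force
    it to vanish. *)
Lemma collinear_det (p q r : point) (a b c : R) : is_line a b c ->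
  on_line a b c p -> on_line a b c q -> on_line a b c r ->
  zero_det p q r.
Proof.
unfold is_line, on_line, zero_det; intros hl hp hq hr.
set (dx := fst q - fst p); set (dy := snd q - snd p).
set (ex := fst r - fst p); set (ey := snd r - snd p).
assert (h1 : a * dx + b * dy = 0) by (unfold dx, dy; lra).
assert (h2 : a * ex + b * ey = 0) by (unfold ex, ey; lra).
destruct (Req_dec (dx * ey - dy * ex) 0) as [h|h]; [lra|].
exfalso; apply hl; split; apply (Rmult_eq_reg_r (dx * ey - dy * ex)); trivial.
- replace (a * (dx * ey - dy * ex)) with
    (ey * (a * dx + b * dy) - dy * (a * ex + b * ey)) by ring.
  rewrite h1, h2; ring.
- replace (b * (dx * ey - dy * ex)) with
    (dx * (a * ex + b * ey) - ex * (a * dx + b * dy)) by ring.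
  rewrite h1, h2; ring.
Qed.

Lemma det_collinear (p q r : point) : p <> q ->
  zero_det p q r ->
  exists a b c : R,
    is_line a b c /\ on_line a b c p /\ on_line a b c q /\ on_line a b c r.
Proof.
unfold zero_det; intros pq h.
exists (snd q - snd p), (- (fst q - fst p)),
  ((snd q - snd p) * fst p - (fst q - fst p) * snd p).
unfold is_line, on_line; repeat split; try lra.
intros [h1 h2]; apply pq; destruct p, q; simpl in *; f_equal; lra.
Qed.

(** Uniqueness of signed digits: [c0] is a multiple of [M] below [M] in absolute value, hence zero;
    the next digit follows likewise. *)
Lemma radix_zero (M c0 c1 c2 : Z) :
  (Z.abs c0 < M -> Z.abs c1 < M -> Z.abs c2 < M ->
   c0 + c1 * M + c2 * (M * M) = 0 -> c0 = 0 /\ c1 = 0 /\ c2 = 0)%Z.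
Proof.
intros h0 h1 h2 h.
assert (z : forall c k : Z, (Z.abs c < M -> c + k * M = 0 -> c = 0 /\ k = 0)%Z).
{ intros c k hc e; assert (k = 0)%Z by nia; subst k; lia. }
destruct (z c0 (c1 + c2 * M)%Z h0) as [e0 e]; [lia|].
destruct (z c1 c2 h1) as [e1 e2]; [lia|]; auto.
Qed.

Lemma incl_map_preimage {A B : Type} (f : A -> B) (l : list A) (T : list B) :
  incl T (map f l) -> exists J, T = map f J /\ incl J l.
Proof.
induction T as [|y T IH]; intros h.
- exists nil; split; [reflexivity|intros x []].
- destruct IH as [J [e hJ]]; [intros z hz; apply h; now right|].
  assert (hy := h y (or_introl eq_refl)); apply in_map_iff in hy.
  destruct hy as [x [e' hx]]; exists (x :: J); split; [simpl; congruence|].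
  intros z [<-|hz]; auto.
Qed.

Lemma nat_root (k n : nat) : (1 <= k)%nat -> (1 <= n)%nat ->
  exists b, (b ^ k < n /\ n <= (S b) ^ k)%nat.
Proof.
intros hk hn; induction hn as [|n hn [b [h1 h2]]].
- exists 0%nat; rewrite Nat.pow_0_l, Nat.pow_1_l; lia.
- destruct (Nat.le_gt_cases (S n) (S b ^ k)) as [h|h].
  + exists b; lia.
  + exists (S b); split; [lia|].
    assert (S b ^ k < S (S b) ^ k)%nat by (apply Nat.pow_lt_mono_l; lia); lia.
Qed.

(** For b^(6u-3) < n <= (b+1)^(6u-3), any [n] points of the set built for b+1 inherit both
    properties, and replacing b+1 by [b] in the bound costs one factor [b]. *)
Lemma alpha_le_of_powers (bound : nat -> nat) :
  (forall u b : nat, (0 < u)%nat -> (bound u <= b)%nat ->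
    exists L : list point, NoDup L /\ (b ^ (6 * u - 3) <= length L)%nat /\
      no_four_on_a_line L /\
      forall T, subset_of T L -> general_position T ->
        (length T <= b ^ (5 * u + 4))%nat) ->
  forall delta : R, 0 < delta ->
  exists N : nat, forall n : nat, (N <= n)%nat ->
    exists S : list point,
      finite_set S /\ length S = n /\ no_four_on_a_line S /\
      alpha_le S (Rpower (INR n) (5 / 6 + delta)).
Proof.
intros planar delta hd.
(* The exponents must satisfy 5u + 5 <= (6u - 3)(5/6 + delta), that is 15/2 <= (6u - 3) delta. As 6u
   - 3 >= 3u, it is enough that delta u > 3. *)
destruct (INR_unbounded (3 / delta)) as [u hu].
assert (u0 : (0 < u)%nat).
{ apply INR_lt; simpl; apply Rlt_trans with (3 / delta); [|lra].
  apply Rdiv_lt_0_compat; lra. }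
assert (hdu : 3 < delta * INR u).
{ apply (Rmult_lt_compat_l delta) in hu; [|lra].
  replace (delta * (3 / delta)) with 3 in hu by (field; lra); lra. }
set (k := (6 * u - 3)%nat); set (e := (5 * u + 4)%nat).
assert (hk : (1 <= k)%nat) by (unfold k; lia).
(* The summand [2 ^ e] yields (b+1)^e <= (2b)^e <= b^(e+1). *)
set (B := (bound u + 2 ^ e)%nat).
assert (B0 : (1 <= B)%nat) by (unfold B; pose proof (Nat.pow_nonzero 2 e); lia).
exists (S (S B ^ k)); intros n hn.
destruct (nat_root k n hk) as [b [hb1 hb2]]; [lia|].
assert (hB : (B <= b)%nat).
{ destruct (Nat.le_gt_cases B b) as [h|h]; trivial; exfalso.
  assert (S b ^ k <= S B ^ k)%nat by (apply Nat.pow_le_mono_l; lia); lia. }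
destruct (planar u (S b) u0) as [L [hL1 [hL2 [hL3 hL4]]]]; [unfold B in hB; lia|].
assert (sub : incl (firstn n L) L).
{ intros x hx; rewrite <- (firstn_skipn n L); apply in_or_app; now left. }
exists (firstn n L); repeat split.
- red; rewrite <- (firstn_skipn n L) in hL1; now apply NoDup_app_remove_r in hL1.
- apply firstn_length_le; fold k in hL2; lia.
- intros p q r s hp hq hr hs; apply hL3; apply sub; assumption.
- intros T [hT1 hT2] hT3.
  assert (hT : (length T <= b ^ (S e))%nat).
  { apply Nat.le_trans with (S b ^ e)%nat.
    - apply hL4; trivial; split; trivial.
      intros x hx; apply sub, hT2, hx.
    - apply Nat.le_trans with ((2 * b) ^ e)%nat; [apply Nat.pow_le_mono_l; lia|].
      rewrite Nat.pow_mul_l; simpl; apply Nat.mul_le_mono_r; unfold B in hB; lia. }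
  assert (b1 : 1 <= INR b) by (apply (le_INR 1); lia).
  apply Rle_trans with (Rpower (INR b) (INR (S e))).
  + rewrite Rpower_pow, <- pow_INR by lra; now apply le_INR.
  + apply Rle_trans with (Rpower (INR b) (INR k * (5 / 6 + delta))).
    * apply Rle_Rpower; trivial.
      unfold k, e; rewrite S_INR, plus_INR, mult_INR, minus_INR, mult_INR by lia.
      simpl; assert (1 <= INR u) by (apply (le_INR 1); lia); nra.
    * rewrite <- Rpower_mult; apply Rle_Rpower_l; [lra|].
      rewrite Rpower_pow, <- pow_INR by lra; split.
      -- apply (lt_INR 0); pose proof (Nat.pow_nonzero b k); lia.
      -- apply le_INR; lia.
Qed.

Module GridPoints.

Import all_boot zify.
Set Implicit Arguments.
Unset Strict Implicit.
Unset Printing Implicit Defensive.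
Local Open Scope nat_scope.

(** * Containers *)

Section Containers.
Variable V : finType.
Implicit Types (E G : {set {set V}}) (A B C I X T : {set V}).

Definition deg E (x : V) := #|[set e in E | x \in e]|.
Definition avoid E B := [set e in E | [disjoint e & B]].
Definition indep E I := forall e, e \in E -> ~~ (e \subset I).

Lemma sum_deg E B : \sum_(x in B) deg E x = \sum_(e in E) #|e :&: B|.
Proof.
transitivity (\sum_(x in B) \sum_(e in E) (x \in e : nat)).
  apply: eq_bigr => x _; rewrite /deg -sum1_card big_mkcond /= [RHS]big_mkcond /=.
  by apply: eq_bigr => e _; rewrite !inE; case: (e \in E); case: (x \in e).
rewrite exchange_big /=; apply: eq_bigr => e _.
rewrite -sum1_card big_mkcond /= [RHS]big_mkcond /=.
by apply: eq_bigr => x _; rewrite !inE; case: (x \in e); case: (x \in B).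
Qed.

Lemma card_avoid E B : #|E| <= #|avoid E B| + \sum_(x in B) deg E x.
Proof.
rewrite sum_deg -!sum1_card [X in X + _]big_mkcond /= [X in _ + X]big_mkcond /=.
rewrite -big_split /= big_mkcond /=; apply: leq_sum => e _; rewrite !inE.
case: (e \in E) => //=; case: ifP => // /negbT.
by rewrite -setI_eq0 -card_gt0 => ->.
Qed.

Lemma exists_large_degree A E r :
  (forall e, e \in E -> e \subset A /\ #|e| = r) -> 0 < r * #|E| ->
  exists2 x, x \in A & r * #|E| <= deg E x * #|A|.
Proof.
move=> hE pos.
have hs : \sum_(x in A) deg E x = r * #|E|.
  rewrite sum_deg mulnC -sum_nat_const; apply: eq_bigr => e /hE[sub <-].
  by rewrite (setIidPl sub).
case: (pickP [pred x in A | r * #|E| <= deg E x * #|A|]) => [x /andP[xA hx]|no].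
  by exists x.
have [A0|A0] := posnP #|A|.
  by move: pos; rewrite -hs (cards0_eq A0) big_set0.
have : \sum_(x in A) deg E x * #|A| <= \sum_(x in A) (r * #|E|).-1.
  apply: leq_sum => x xA; have := no x; rewrite inE xA /= => /negbT.
  by rewrite -ltnNge; case: (r * _) pos.
by rewrite -big_distrl /= hs sum_nat_const mulnC leq_pmul2l //; case: (r * _) pos => //= z _; lia.
Qed.

(** Recurrence for the leaves of the decision trees: each query settles a vertex; a negative answer
    keeps the budget of [s.+1] positive answers, a positive one leaves [s]. *)
Lemma branch_leaves j s : j.+1 ^ s.+1 + j.+1 ^ s <= j.+2 ^ s.+1.
Proof.
rewrite !expnS -mulSnr leq_mul2l /=.
by case: s => // s; rewrite leq_exp2r.
Qed.

(** A rejected vertex is settled alone, an accepted one together with its neighbours. Once the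
    settled set [X] meets more than half of the edges, the degree bound makes [X] large, and
    [A :\: X :|: T] is a container, with [x] the size of [X]. *)
Lemma graph_containers A G t w :
  (forall e, e \in G -> e \subset A /\ #|e| = 2) ->
  (forall x, deg G x * #|A| <= w) -> #|A| * #|A| < t * #|G| ->
  exists L : seq {set V}, [/\ size L <= #|A|.+1 ^ t,
    forall C, C \in L ->
      exists2 x, #|C| + x <= #|A| + t & #|G| * #|A| <= 2 * w * x &
    forall I, I \subset A -> indep G I -> exists2 C, C \in L & I \subset C].
Proof.
move=> hG hdeg ht.
have G0 : 0 < #|G| by nia.
(* [T] holds the accepted vertices and [s] counts the acceptances still allowed. The third condition
   says that an acceptance settles at least |G|/|A| vertices on average. *)
suff main : forall j s X T, #|A :\: X| <= j -> #|T| + s = t ->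
    #|T| * #|G| <= #|X| * #|A| -> X \subset A ->
  exists L : seq {set V}, [/\ size L <= j.+1 ^ s,
    forall C, C \in L ->
      exists2 x, #|C| + x <= #|A| + t & #|G| * #|A| <= 2 * w * x &
    forall I, I \subset A -> indep G I -> T \subset I -> I :&: X \subset T ->
      exists2 C, C \in L & I \subset C].
  have [] := main #|A| t set0 set0.
  - by rewrite setD0.
  - by rewrite cards0.
  - by rewrite cards0.
  - by rewrite sub0set.
  move=> L [h1 h2 h3]; exists L; split => // I IA iI.
  by apply: h3; rewrite ?sub0set ?setI0 ?sub0set.
elim=> [|j IH] s X T hj hT hTX hX; set G' := avoid G X.
  all: have [few|many] := ltnP (2 * #|G'|) #|G|.
  1,3: exists [:: A :\: X :|: T]; split=> [|C|I IA iI TI IX] /=.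
  1,4: by rewrite expn_gt0.
  1,3: rewrite inE => /eqP->; exists #|X|.
  1,3: have := cardsDS hX; have := subset_leq_card hX; have := (leq_card_setU (A :\: X) T).1; lia.
  1,2: have h1 := card_avoid G X; rewrite -/G' in h1.
  1,2: have h2 : (\sum_(x in X) deg G x) * #|A| <= #|X| * w
         by rewrite big_distrl /= -sum_nat_const; apply: leq_sum => x _.
  1,2: move: h1 h2; set sd := \sum_(x in X) _ => h1 h2.
  1,2: have h3 : #|G| <= 2 * sd by lia.
  1,2: by apply: (leq_trans (leq_mul h3 (leqnn _))); nia.
  1,2: exists (A :\: X :|: T); rewrite ?inE //; apply/subsetP => x xI; rewrite !inE.
  1,2: have [xX|xX] := boolP (x \in X); last by rewrite (subsetP IA).
  1,2: by rewrite (subsetP IX) ?orbT // inE xI.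
  all: have hG' : forall e, e \in G' -> e \subset A /\ #|e| = 2
         by move=> e; rewrite inE => /andP[/hG].
  all: have [|v vA hv] := exists_large_degree hG'; first by lia.
  all: have vX : v \notin X.
  1,3: have : 0 < deg G' v by nia.
  1,2: rewrite /deg card_gt0 => /set0Pn[e]; rewrite !inE => /andP[/andP[_ dis] ve].
  1,2: by rewrite (disjointFr dis).
  1: by exfalso; move: hj; rewrite leqn0 cards_eq0 => /eqP/setP/(_ v); rewrite !inE vA vX.
(* If [v] is in [I], independence excludes all of [N], which has at least 2|G'|/|A| >= |G|/|A|
   elements. *)
pose N := [set y | (y != v) && ([set v; y] \in G')].
have hN : deg G' v <= #|N|.
  apply: (@leq_trans #|[set [set v; y] | y in N]|); last exact: leq_imset_card.
  apply: subset_leq_card; apply/subsetP => e; rewrite inE => /andP[eG ve].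
  have [_ /eqP/cards2P[x [y [xy eE]]]] := hG' _ eG.
  have : v \in [set x; y] by rewrite -eE.
  rewrite !inE => /orP[]/eqP vE; apply/imsetP.
    by subst x; exists y => //; rewrite /N inE -eE eG eq_sym xy.
  by subst y; rewrite setUC in eE; exists x => //; rewrite /N inE -eE eG xy.
have NA : N \subset A :\: X.
  apply/subsetP => y; rewrite inE => /andP[_]; rewrite inE => /andP[/hG[sub _] dis].
  rewrite inE (subsetP sub) ?andbT ?inE ?eqxx ?orbT //.
  by rewrite (disjointFr dis) // !inE eqxx orbT.
have NX : N :&: X = set0.
  apply/setP => y; rewrite in_set0 in_setI; apply/negP => /andP[/(subsetP NA)].
  by rewrite inE => /andP[/negP].
have vT : v |: X \subset A by rewrite subUset sub1set vA.
have hjv : #|A :\: (v |: X)| <= j.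
  have := cardsDS vT; have := cardsDS hX; rewrite cardsU1 vX.
  have := subset_leq_card vT; rewrite cardsU1 vX; lia.
have hTv : #|T| * #|G| <= #|v |: X| * #|A| by rewrite cardsU1; nia.
have [Ln [n1 n2 n3]] := IH s (v |: X) T hjv hT hTv vT.
pose X' := v |: (X :|: N).
have X'A : X' \subset A.
  by rewrite !subUset sub1set vA hX (subset_trans NA) ?subsetDl.
have cX' : #|X| + #|N| <= #|X'|.
  have := subset_leq_card (subsetUr [set v] (X :|: N)); rewrite -/X'.
  by rewrite cardsU setIC NX cards0; lia.
have hT' : #|v |: T| * #|G| <= #|X'| * #|A|.
  have : #|v |: T| <= #|T|.+1 by rewrite cardsU1; lia.
  nia.
have sX' := subset_leq_card X'A.
(* If [v] is already in [T], it is known to lie in [I], and it is settled without branching. *)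
have [vT'|vT'] := boolP (v \in T).
  exists Ln; split=> [||I IA iI TI IX] //.
    apply: leq_trans n1 _; case: (s) => // s'; rewrite leq_exp2r //.
  apply: n3 => //; apply/subsetP => x; rewrite !inE => /andP[xI /orP[/eqP->//|xX]].
  by rewrite (subsetP IX) // inE xI.
have {}hT' : #|T|.+1 * #|G| <= #|X'| * #|A| by rewrite cardsU1 vT' in hT'.
(* With the budget exhausted, one more acceptance would give (t+1)|G| <= |A|^2, against |A|^2 <
   t|G|. *)
case: s hT n1 => [|s] hT n1; first by exfalso; nia.
have [||||Ly [y1 y2 y3]] // := IH s X' (v |: T).
- apply: leq_trans hjv; apply: subset_leq_card; apply: setDS.
  by rewrite /X' setUA subsetUl.
- by rewrite cardsU1 vT'; lia.
- by rewrite cardsU1 vT'.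
exists (Ln ++ Ly); split=> [|C|I IA iI TI IX].
- by rewrite size_cat; have := branch_leaves j s; lia.
- by rewrite mem_cat => /orP[/n2|/y2].
have [vI|vI] := boolP (v \in I).
  have [||C CL IC] := y3 I IA iI.
  - by rewrite subUset sub1set vI.
  - apply/subsetP => x; rewrite !inE => /andP[xI /or3P[->//|xX|/and3P[_ xN _]]].
      by rewrite (subsetP IX) ?orbT // inE xI.
    by have /negP[] := iI _ xN; rewrite subUset !sub1set vI.
  by exists C => //; rewrite mem_cat CL orbT.
have [|C CL IC] := n3 I IA iI TI.
  apply/subsetP => x; rewrite !inE => /andP[xI /orP[/eqP xv|xX]].
    by rewrite -xv xI in vI.
  by rewrite (subsetP IX) // inE xI.
by exists C => //; rewrite mem_cat CL.
Qed.

End Containers.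

(** * Containers for linear 3-uniform hypergraphs *)

Section LinearContainers.
Variable V : finType.
Implicit Types (E G : {set {set V}}) (A B C I X T R : {set V}).

Definition linear E := forall e f x y, e \in E -> f \in E -> x != y ->
  x \in e -> y \in e -> x \in f -> y \in f -> e = f.

Definition link E v := [set e :\ v | e in [set e in E | v \in e]].

Lemma card_link E v : #|link E v| = deg E v.
Proof.
rewrite card_in_imset // => e f; rewrite !inE => /andP[_ ve] /andP[_ vf] ef.
by rewrite -(setD1K ve) ef setD1K.
Qed.

Lemma deg_link E v x : linear E -> deg (link E v) x <= 1.
Proof.
move=> lin; apply/card_le1_eqP => g h; rewrite !inE.
move=> /andP[/imsetP[e eE ->] xe] /andP[/imsetP[f fE ->] xf].
move: eE fE xe xf; rewrite !inE => /andP[eE ve] /andP[fE vf] /andP[xv xe] /andP[_ xf].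
by rewrite (lin e f x v).
Qed.

Lemma degU E F x : deg (E :|: F) x <= deg E x + deg F x.
Proof.
apply: leq_trans (leq_card_setU _ _).1.
by apply: subset_leq_card; apply/subsetP => e; rewrite !inE andb_orl.
Qed.

Lemma card_high_degree A G c :
  (forall e, e \in G -> e \subset A /\ #|e| = 2) ->
  #|[set x in A | c <= deg G x * #|A|]| * c <= 2 * #|G| * #|A|.
Proof.
move=> hG; rewrite -sum_nat_const.
apply: (@leq_trans (\sum_(x in [set x in A | c <= deg G x * #|A|]) deg G x * #|A|)).
  by apply: leq_sum => x; rewrite inE => /andP[].
rewrite -big_distrl /= sum_deg leq_mul2r; apply/orP; right.
rewrite mulnC -sum_nat_const; apply: leq_sum => e /hG[_ <-].
by rewrite subset_leq_card // subsetIl.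
Qed.

(** Accepting [v] into [I] turns its link into edges of a graph [G] in which [I] is independent.
    After [t] acceptances [graph_containers] applies to [G]; if the rejected set [R] reaches |A|/36
    earlier, [A :\: R] is itself a container. *)
Lemma linear_containers A E D t :
  (forall e, e \in E -> e \subset A /\ #|e| = 3) -> linear E ->
  (forall x, deg E x <= D) -> D * #|A| <= 6 * #|E| ->
  2000 * t <= #|A| -> 0 < #|A| <= D * t -> 4 * #|A| * #|A| < t * t * D ->
  exists L : seq {set V}, [/\ size L <= #|A|.+1 ^ (2 * t),
    forall C, C \in L -> 1000 * #|C| <= 999 * #|A| &
    forall I, I \subset A -> indep E I -> exists2 C, C \in L & I \subset C].
Proof.
move=> hE lin hdeg cE ta /andP[a0 aDt] ttD.
(* Each acceptance adds between D/4 and D edges to [G]. The last summand [#|A|] of the degree bound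
   allows for the single edge by which a link can raise a degree still below the threshold
   72Dt/|A|. *)
suff main : forall j s R T G, #|A :\: (R :|: T)| <= j -> #|T| + s = t ->
    R \subset A -> T \subset A ->
    (forall g, g \in G -> exists e v, [/\ e \in E, v \in e, v \in T & g = e :\ v]) ->
    #|T| * D <= 4 * #|G| -> #|G| <= #|T| * D ->
    (forall x, deg G x * #|A| <= 72 * D * t + #|A|) ->
  exists L : seq {set V}, [/\ size L <= j.+1 ^ s * #|A|.+1 ^ t,
    forall C, C \in L -> 1000 * #|C| <= 999 * #|A| &
    forall I, I \subset A -> indep E I -> T \subset I -> [disjoint I & R] ->
      exists2 C, C \in L & I \subset C].
  have [||||||||L [h1 h2 h3]] := main #|A| t set0 set0 set0.
  - by rewrite setU0 setD0.
  - by rewrite cards0.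
  - by rewrite sub0set.
  - by rewrite sub0set.
  - by move=> g; rewrite inE.
  - by rewrite cards0.
  - by rewrite cards0.
  - move=> x; rewrite /deg (_ : [set e in set0 | _] = set0) ?cards0 //.
    by apply/setP => e; rewrite !inE.
  exists L; split => //; first by rewrite mul2n -addnn expnD.
  by move=> I IA iI; apply: h3; rewrite ?sub0set // -setI_eq0 setI0.
move=> j; have [k] := ubnP j; elim: k j => // k IH j jk s R T G hj hs RA TA hG Glo Ghi Gdeg.
have G2 : forall g, g \in G -> g \subset A /\ #|g| = 2.
  move=> g /hG[e [v [/hE[eA e3] ve _ ->]]]; split.
    by rewrite (subset_trans (subsetDl _ _)).
  by have := cardsD1 v e; rewrite ve e3 => -[].
have GI I : indep E I -> T \subset I -> indep G I.
  move=> iI TI g /hG[e [v [eE ve vT ->]]]; apply/negP => sub.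
  have /negP[] := iI _ eE; rewrite -(setD1K ve) subUset sub andbT sub1set.
  exact: subsetP TI _ vT.
have lexp : 0 < j.+1 ^ s * #|A|.+1 ^ t by rewrite muln_gt0 !expn_gt0.
have [Rbig|Rsmall] := leqP #|A| (36 * #|R|).
  exists [:: A :\: R]; split=> // [C|I IA iI TI IR].
    rewrite inE => /eqP->; have := cardsDS RA; have := subset_leq_card RA; lia.
  exists (A :\: R); first by rewrite inE.
  by rewrite subsetD IA.
case: s hs lexp => [|s] hs lexp.
  have tT : #|T| = t by lia.
  rewrite tT in Glo Ghi.
  have Gd x : deg G x * #|A| <= 73 * (D * t) by have := Gdeg x; lia.
  have [|L [l1 l2 l3]] := graph_containers (t := t) G2 Gd; first by nia.
  exists L; split=> [|C /l2[x Cx xG]|I IA iI TI IR]; first by rewrite mul1n.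
    (* 584 = 4 * 2 * 73. Since |C| <= |A| + t - x with t <= |A|/2000, the loss is enough because
       1/584 - 1/2000 > 1/1000. *)
    have : #|A| <= 584 * x; last by lia.
    have Dt0 : 0 < D * t by lia.
    rewrite -(leq_pmul2l Dt0); apply: (@leq_trans (4 * (#|G| * #|A|))); last by nia.
    by rewrite mulnA leq_mul2r mulnC Glo orbT.
  by apply: l3 => //; apply: GI.
(* As |G| <= Dt, Markov's inequality gives |high| <= |A|/36. So [B] has at most |A|/12 vertices and
   meets at most D|A|/12 of the at least D|A|/6 edges, which leaves a vertex of degree at least D/4
   in [H]. *)
pose high := [set x in A | 72 * D * t <= deg G x * #|A|].
pose B := R :|: T :|: high.
have cB : 12 * #|B| <= #|A|.
  have h1 : 36 * #|high| <= #|A|.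
    have h2 := card_high_degree (72 * D * t) G2; rewrite -/high in h2.
    have h3 : 0 < D * t by lia.
    have h4 : #|T| * D <= D * t by nia.
    rewrite -(leq_pmul2l h3).
    have h5 : #|G| * #|A| <= D * t * #|A| by rewrite leq_mul2r (leq_trans Ghi) ?orbT.
    nia.
  have := (leq_card_setU (R :|: T) high).1; have := (leq_card_setU R T).1; rewrite -/B.
  lia.
pose H := avoid E B.
have HA : forall e, e \in H -> e \subset A /\ #|e| = 3.
  by move=> e; rewrite inE => /andP[/hE].
have cH : D * #|A| <= 12 * #|H|.
  have h1 := card_avoid E B; rewrite -/H in h1.
  have h2 : \sum_(x in B) deg E x <= #|B| * D.
    by rewrite -sum_nat_const; apply: leq_sum => x _.
  have h3 : 12 * (#|B| * D) <= D * #|A| by rewrite mulnA mulnC leq_mul2l cB orbT.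
  lia.
have [|v vA hv] := exists_large_degree HA; first by nia.
have {}hv : D <= 4 * deg H v.
  rewrite -(leq_pmul2r a0) (leq_trans cH) // -mulnA (_ : 12 = 4 * 3) // -mulnA leq_mul2l.
  exact: hv.
have vB : v \notin B.
  have : 0 < deg H v by case: (deg H v) hv => //; nia.
  rewrite /deg card_gt0 => /set0Pn[e]; rewrite [e \in _]inE => /andP[].
  by rewrite [e \in _]inE => /andP[_ dis] ve; rewrite (disjointFr dis).
have /norP[/norP[vR vT] _] : ~~ ((v \in R) || (v \in T) || (v \in high)).
  by move: vB; rewrite !in_setU.
case: j jk hj lexp => [|j] jk hj lexp.
  by exfalso; move: hj; rewrite leqn0 cards_eq0 => /eqP/setP/(_ v);
    rewrite !inE vA (negPf vR) (negPf vT).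
have hjv : #|A :\: (v |: (R :|: T))| <= j.
  have vRT : v |: (R :|: T) \subset A by rewrite !subUset sub1set vA RA TA.
  have RTA : R :|: T \subset A by rewrite !subUset RA TA.
  have := cardsDS vRT; have := cardsDS RTA; have := subset_leq_card vRT.
  by rewrite cardsU1 inE (negPf vR) (negPf vT) /=; clear -hj; lia.
have [||||||||Ln [n1 n2 n3]] // := IH j jk s.+1 (v |: R) T G.
- by rewrite -setUA.
- by rewrite subUset sub1set vA.
have linH : linear H.
  by move=> e f x y; rewrite !inE => /andP[eE _] /andP[fE _]; apply: lin.
(* A common edge e \ v' = f \ v has two vertices, so e = f by linearity; but e contains v' in [T],
   while edges of [H] avoid [T]. *)
have GH : [disjoint G & link H v].
  apply/pred0P => g /=; apply/negP => /andP[/hG[e [v' [eE ve' vT' ->]]] /imsetP[f]].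
  rewrite !inE => /andP[/andP[fE dis] vf] ef.
  have [_ /eqP/cards2P[x [y [xy exy]]]] : e :\ v' \subset A /\ #|e :\ v'| = 2.
    split; first by rewrite (subset_trans (subsetDl _ _)) //; case: (hE e).
    by have := cardsD1 v' e; rewrite ve'; have [_ ->] := hE _ eE => -[].
  have [xe ye] : x \in e :\ v' /\ y \in e :\ v' by rewrite exy !inE !eqxx orbT.
  have efE : e = f.
    move: (xe) (ye); rewrite ef => xf yf.
    apply: (lin e f x y) => //; [move: xe|move: ye|move: xf|move: yf];
      by rewrite inE => /andP[].
  have := disjointFr dis; rewrite -efE => /(_ _ ve').
  by rewrite !inE vT' orbT.
have cGH : #|G :|: link H v| = #|G| + deg H v.
  by apply/eqP; rewrite -card_link (leq_card_setU G (link H v)).2.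
have [||||||||Ly [y1 y2 y3]] // := IH j jk s R (v |: T) (G :|: link H v).
- by rewrite setUCA.
- by rewrite cardsU1 vT -hs add1n addSnnS.
- by rewrite subUset sub1set vA.
- move=> g; rewrite inE => /orP[/hG[e [v' [eE ve' vT' ->]]]|/imsetP[e]].
    by exists e, v'; rewrite inE vT' orbT.
  by rewrite !inE => /andP[/andP[eE _] ve] ->; exists e, v; rewrite !inE eqxx.
- by rewrite cardsU1 vT cGH add1n mulSn mulnDr addnC leq_add.
- rewrite cardsU1 vT cGH add1n mulSn addnC leq_add //.
  apply: leq_trans (hdeg v); apply: subset_leq_card; apply/subsetP => e.
  by rewrite !inE => /andP[/andP[-> _] ->].
(* Only vertices outside [B], hence outside [high], gain an edge, and by linearity just one. *)
- move=> x; have h1 := degU G (link H v) x.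
  have [xl|xl] := posnP (deg (link H v) x).
    by apply: leq_trans (Gdeg x); rewrite xl addn0 in h1; rewrite leq_mul2r h1 orbT.
  have h2 := deg_link v x linH.
  have xB : x \notin B.
    move: xl; rewrite /deg card_gt0 => /set0Pn[g]; rewrite inE => /andP[/imsetP[e]].
    rewrite !in_set => /andP[/andP[eE dis] ve] ->; rewrite !inE => /andP[_ xe].
    by have := disjointFr dis xe; rewrite !inE => ->.
  have xA : x \in A.
    move: xl; rewrite /deg card_gt0 => /set0Pn[g]; rewrite inE => /andP[/imsetP[e]].
    rewrite !in_set => /andP[/andP[eE dis] ve] ->; rewrite !inE => /andP[_ xe].
    by have [/subsetP->] := hE _ eE.
  have hx : deg G x * #|A| < 72 * D * t.
    by rewrite ltnNge; move: xB; rewrite !in_setU !negb_or => /andP[_]; rewrite inE xA.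
  apply: leq_trans (leq_mul (leq_trans h1 (leq_add (leqnn _) h2)) (leqnn _)) _.
  by rewrite mulnDl mul1n leq_add2r ltnW.
exists (Ln ++ Ly); split=> [|C|I IA iI TI IR].
- rewrite size_cat; apply: leq_trans (leq_add n1 y1) _.
  by rewrite -mulnDl leq_mul2r branch_leaves orbT.
- by rewrite mem_cat => /orP[/n2|/y2].
have [vI|vI] := boolP (v \in I).
  have [||C CL IC] := y3 I IA iI => //.
    by rewrite subUset sub1set vI.
  by exists C => //; rewrite mem_cat CL orbT.
have [|C CL IC] := n3 I IA iI TI.
  by rewrite -setI_eq0 setIUr setU_eq0 !setI_eq0 IR andbT disjoint_sym disjoints1.
by exists C => //; rewrite mem_cat CL.
Qed.

(** Every round scales the sizes by at most 999/1000 and multiplies the number of containers by at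
    most [s]. *)
Lemma iterate_containers (P : {set V} -> Prop) K s :
  (forall A, K <= #|A| -> exists L : seq {set V}, [/\ size L <= s,
     forall C, C \in L -> 1000 * #|C| <= 999 * #|A| &
     forall I, I \subset A -> P I -> exists2 C, C \in L & I \subset C]) ->
  0 < s -> forall j A, #|A| * 999 ^ j < K * 1000 ^ j ->
  exists L : seq {set V}, [/\ size L <= s ^ j, forall C, C \in L -> #|C| < K &
    forall I, I \subset A -> P I -> exists2 C, C \in L & I \subset C].
Proof.
move=> step s0; elim=> [|j IH] A hA.
  exists [:: A]; split=> // [C|I IA _]; first by rewrite inE => /eqP->; lia.
  by exists A; rewrite ?inE.
have [Ksmall|Kbig] := ltnP #|A| K.
  exists [:: A]; split=> // [|C|I IA _]; first by rewrite /= expn_gt0 s0.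
    by rewrite inE => /eqP->.
  by exists A; rewrite ?inE.
have [L [l1 l2 l3]] := step A Kbig.
have l2' C : C \in L -> #|C| * 999 ^ j < K * 1000 ^ j.
  move=> /l2 hC; rewrite !expnS in hA; nia.
clear step l2 Kbig hA.
have : exists M : seq {set V}, [/\ size M <= size L * s ^ j,
    forall C, C \in M -> #|C| < K &
    forall C I, C \in L -> I \subset C -> P I -> exists2 C', C' \in M & I \subset C'].
  elim: L l2' {l1 l3} => [|C L IHL] hL; first by exists [::].
  have [|M [m1 m2 m3]] := IHL; first by move=> C' C'L; apply: hL; rewrite inE C'L orbT.
  have [|M' [m1' m2' m3']] := IH C; first by apply: hL; rewrite inE eqxx.
  exists (M' ++ M); split=> [|C'|C' I].
  - by rewrite size_cat mulSn leq_add.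
  - by rewrite mem_cat => /orP[/m2'|/m2].
  rewrite inE => /orP[/eqP->|C'L] IC PI.
    by have [C'' ? ?] := m3' I IC PI; exists C''; rewrite // mem_cat; apply/orP; left.
  by have [C'' ? ?] := m3 C' I C'L IC PI; exists C''; rewrite // mem_cat; apply/orP; right.
case=> M [m1 m2 m3]; exists M; split=> // [|I IA PI].
  by rewrite expnS (leq_trans m1) // leq_mul2r l1 orbT.
by have [C CL IC] := l3 I IA PI; apply: m3 CL IC PI.
Qed.

End LinearContainers.

(** * Collinear triples of the grid *)

(** Greedy choice: while more than 2c points remain, the pigeonhole principle finds three of them in
    one fibre of [f]. *)
Lemma triple_packing (T U : finType) (f : T -> U) c (A : {set T}) :
  #|f @: A| <= c ->
  exists P : {set {set T}}, [/\
    forall e, e \in P ->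
      [/\ e \subset A, #|e| = 3 & {in e &, forall x y, f x = f y}],
    forall e e' x, e \in P -> e' \in P -> x \in e -> x \in e' -> e = e' &
    #|A| <= 3 * #|P| + 2 * c].
Proof.
have [k] := ubnP #|A|; elim: k A => // k IH A Ak hc.
have [Asmall|Abig] := leqP #|A| (2 * c).
  by exists set0; split=> [e|e e' x|]; rewrite ?inE // cards0.
have [u cu] : exists u, 2 < #|[set x in A | f x == u]|.
  case: (pickP (fun u => 2 < #|[set x in A | f x == u]|)) => [u hu|no]; first by exists u.
  have : #|A| <= #|f @: A| * 2; last by lia.
  rewrite -sum_nat_const -sum1_card (partition_big_imset f) /=.
  by apply: leq_sum => u _; have /negbT := no u; rewrite -leqNgt -sum1dep_card.
have /card_gt2P[x [y [z [[xA yA zA] [xy yz zx]]]]] := cu.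
move: xA yA zA; rewrite !inE => /andP[xA /eqP fx] /andP[yA /eqP fy] /andP[zA /eqP fz].
pose e := [set x; y; z].
have e3 : #|e| = 3 by rewrite cardsU cards2 cards1 xy (_ : _ :&: _ = set0) ?cards0 //;
  apply/setP => w; rewrite !inE; apply/negP => /andP[/orP[]/eqP-> /eqP h];
  rewrite h eqxx in zx yz.
have eA : e \subset A by rewrite !subUset !sub1set xA yA zA.
have [||P [p1 p2 p3]] := IH (A :\: e).
- by have := cardsDS eA; have := subset_leq_card eA; lia.
- by apply: leq_trans hc; apply: subset_leq_card; apply: imsetS; apply: subsetDl.
have disj g w : g \in P -> w \in g -> w \notin e.
  by move=> /p1[/subsetP gA _ _] /gA; rewrite inE => /andP[].
exists (e |: P); split.
- move=> g /setU1P[->|/p1[gA g3 gf]]; split=> //.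
    move=> v w ve we; transitivity u; [move: ve|move: we];
    by rewrite !inE => /orP[/orP[]|]/eqP->.
  by rewrite (subset_trans gA) ?subsetDl.
- move=> g g' w /setU1P[->|gP] /setU1P[->|gP'] wg wg' //.
  + by rewrite (negPf (disj _ _ gP' wg')) in wg.
  + by rewrite (negPf (disj _ _ gP wg)) in wg'.
  exact: p2 gP gP' wg wg'.
have eP : e \notin P.
  by apply/negP => /(disj e x); rewrite !inE eqxx => /(_ isT).
rewrite cardsU1 eP add1n; have := cardsDS eA; have := subset_leq_card eA; lia.
Qed.

(** An index [i] of ['I_k] stands for the entry [i.+1], so entries run from 1 to [k]. *)
Definition primitive k (d : 'I_k * 'I_k * 'I_k) :=
  gcdn (gcdn d.1.1.+1 d.1.2.+1) d.2.+1 == 1.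

Lemma card_multiples k g : #|[set i : 'I_k | g %| i.+1]| = k %/ g.
Proof.
rewrite divn_count_dvd big_add1 /= big_mkord -sum1dep_card big_mkcond /=.
by apply: eq_bigr => i _; case: (_ %| _).
Qed.

(** Telescoping: 1/g^3 <= 1/(2g(g-1)) bounds the sum by (k^3/2)(1 - 1/j). *)
Lemma sum_cubes_quotients k j : 0 < j ->
  2 * j * \sum_(2 <= g < j.+1) (k %/ g) ^ 3 <= k ^ 3 * j.-1.
Proof.
elim: j => // -[|j] IH _; first by rewrite big_geq ?muln0.
rewrite big_nat_recr //=; have {IH} := IH isT; set S := \sum_(_ <= _ < _) _ => /= IH.
have h1 : k %/ j.+2 * j.+2 <= k by apply: leq_divM.
set q := k %/ j.+2 in h1 *.
have h2 : (q * j.+2) ^ 3 <= k ^ 3 by rewrite leq_exp2r.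
have h3 : 2 * j.+1 * j.+2 * q ^ 3 <= k ^ 3.
  apply: leq_trans h2; rewrite expnMn mulnC leq_mul2l; apply/orP; right.
  by rewrite !expnS expn0; nia.
rewrite -(leq_pmul2r (ltn0Sn j)).
move: (k ^ 3) (q ^ 3) h3 IH => K Q h3 IH; clear -h3 IH.
have IH2 : j.+2 * (2 * j.+1 * S) <= j.+2 * (K * j) by rewrite leq_mul2l IH orbT.
nia.
Qed.

(** The entries of a non-primitive triple share a divisor g >= 2. The union bound over g leaves at
    most half of all triples. *)
Lemma card_primitive k : k ^ 3 <= 2 * #|[set d | @primitive k d]|.
Proof.
have [->//|k0] := posnP k.
pose M g := [set i : 'I_k | g %| i.+1].
pose N := [set d | ~~ @primitive k d].
have hN : #|N| <= \sum_(2 <= g < k.+1) (k %/ g) ^ 3.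
  have sub : N \subset \bigcup_(g < k.+1 | 1 < g) setX (setX (M g) (M g)) (M g).
    apply/subsetP => -[[x y] z]; rewrite inE /primitive /= => hg.
    set g := gcdn _ _ in hg.
    have gx : g %| x.+1 by rewrite (dvdn_trans (dvdn_gcdl _ _)) // dvdn_gcdl.
    have gy : g %| y.+1 by rewrite (dvdn_trans (dvdn_gcdl _ _)) // dvdn_gcdr.
    have gz : g %| z.+1 by rewrite dvdn_gcdr.
    have g0 : 0 < g by rewrite gcdn_gt0 orbT.
    have gk : g < k.+1 by have := dvdn_leq (ltn0Sn _) gz; have := ltn_ord z; lia.
    apply/bigcupP; exists (Ordinal gk); first by rewrite /=; lia.
    by rewrite !inE /= gx gy gz.
  apply: leq_trans (subset_leq_card sub) _.
  apply: (@leq_trans (\sum_(g < k.+1 | 1 < g) (k %/ g) ^ 3)).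
    elim/big_rec2: _ => [|g s S _ IH]; first by rewrite cards0.
    apply: leq_trans (leq_card_setU _ _).1 _; rewrite leq_add //.
    by rewrite !cardsX !card_multiples !expnS expn0 muln1 mulnA.
  rewrite -(big_mkord (fun g => 1 < g) (fun g => (k %/ g) ^ 3)).
  rewrite (@big_cat_nat _ _ _ 2) //= big_nat_cond big_pred0 ?add0n.
    rewrite big_nat_cond [X in _ <= X]big_nat_cond.
    by apply: eq_leq; apply: eq_bigl => i; case: leqP => //=; rewrite ?andbF.
  by move=> i; lia.
have h2 := sum_cubes_quotients k k0.
have h1 : #|[set d | @primitive k d]| + #|N| = k ^ 3.
  rewrite -(_ : #|{: 'I_k * 'I_k * 'I_k}| = k ^ 3); last first.
    by rewrite !card_prod !card_ord !expnS expn0 muln1 mulnA.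
  rewrite -(cardsC [set d | @primitive k d]); congr (_ + #|pred_of_set _|).
  by apply/setP => d; rewrite !inE.
move: hN h1 h2.
move: #|N| #|[set d | @primitive k d]| (\sum_(_ <= _ < _) _) (k ^ 3) => c D S K.
by case: k k0 {M N} => // k _ /= hc h1 h2; nia.
Qed.

(** * Points of the grid and lines in a fixed direction *)

Notation grid n := ('I_n * 'I_n * 'I_n)%type.

Definition cx n (p : grid n) : Z := Z.of_nat p.1.1.
Definition cy n (p : grid n) : Z := Z.of_nat p.1.2.
Definition cz n (p : grid n) : Z := Z.of_nat p.2.

Definition coll n (p q r : grid n) : bool :=
  [&& ((cx q - cx p) * (cy r - cy p) =? (cy q - cy p) * (cx r - cx p))%Z,
      ((cx q - cx p) * (cz r - cz p) =? (cz q - cz p) * (cx r - cx p))%Z &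
      ((cy q - cy p) * (cz r - cz p) =? (cz q - cz p) * (cy r - cy p))%Z].

Definition gen_pos n (I : {set grid n}) :=
  [forall p in I, forall q in I, forall r in I, uniq [:: p; q; r] ==> ~~ coll p q r].

Definition ord_sub n (i : 'I_n) m : 'I_n :=
  Ordinal (leq_ltn_trans (leq_subr m i) (ltn_ord i)).

Section Base.
Variables (n a b c : nat).
Implicit Types p q r : grid n.

(** How often (a, b, c) can be subtracted from [p] within the grid. The point reached, [base p],
    labels the line through [p] in this direction. *)
Definition steps p := minn (p.1.1 %/ a) (minn (p.1.2 %/ b) (p.2 %/ c)).

Definition base p : grid n :=
  (ord_sub p.1.1 (steps p * a), ord_sub p.1.2 (steps p * b),
   ord_sub p.2 (steps p * c)).

Lemma baseE p : [/\ p.1.1 = (base p).1.1 + steps p * a :> nat,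
  p.1.2 = (base p).1.2 + steps p * b :> nat & p.2 = (base p).2 + steps p * c :> nat].
Proof.
have h i d s : s <= i %/ d -> i = i - s * d + s * d.
  by move=> h; rewrite subnK // (leq_trans (leq_mul h (leqnn d))) // leq_divM.
by split; apply: h; rewrite /steps; lia.
Qed.

Lemma coll_base p q r : base p = base q -> base p = base r -> coll p q r.
Proof.
have [px py pz] := baseE p; have [qx qy qz] := baseE q; have [rx ry rz] := baseE r.
move=> pq pr; rewrite -pq in qx qy qz; rewrite -pr in rx ry rz.
rewrite /coll /cx /cy /cz px py pz qx qy qz rx ry rz.
by apply/and3P; split; apply/Z.eqb_spec; lia.
Qed.

(** The subtraction stops when some coordinate is smaller than its step, so the image lies in three
    slabs of at most k n^2 points. *)
Lemma card_base_image k (A : {set grid n}) : 0 < a <= k -> 0 < b <= k -> 0 < c <= k ->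
  #|base @: A| <= 3 * k * (n * n).
Proof.
move=> /andP[a0 ak] /andP[b0 bk] /andP[c0 ck].
pose S := [set i : 'I_n | i < k].
have cS : #|S| <= k.
  have [kn|nk] := leqP k n; last by rewrite (leq_trans (max_card _)) // card_ord ltnW.
  apply: (@leq_trans #|[set widen_ord kn i | i in 'I_k]|); last first.
    by rewrite (leq_trans (leq_imset_card _ _)) // card_ord.
  apply: subset_leq_card; apply/subsetP => i; rewrite inE => ik.
  by apply/imsetP; exists (Ordinal ik) => //; apply: val_inj.
have sub : base @: A \subset setX (setX S setT) setT :|: setX (setX setT S) setT
    :|: setX setT S.
  apply/subsetP => _ /imsetP[p _ ->]; rewrite !inE /= !andbT.
  have h i d : 0 < d -> i - i %/ d * d < d.
    by move=> d0; rewrite {1}(divn_eq i d) addKn ltn_pmod.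
  have := h p.1.1 a a0; have := h p.1.2 b b0; have := h p.2 c c0.
  rewrite /steps; set X := _ %/ a; set Y := _ %/ b; set Z := _ %/ c => hz hy hx.
  set m := minn X (minn Y Z).
  have : m = X \/ m = Y \/ m = Z by rewrite /m; lia.
  move: m => m [->|[->|->]]; [move: hx|move: hy|move: hz] => h'.
  - by rewrite (leq_trans h' ak).
  - by rewrite (leq_trans h' bk) orbT.
  by rewrite (leq_trans h' ck) !orbT.
apply: leq_trans (subset_leq_card sub) _.
apply: leq_trans (leq_card_setU _ _).1 _.
apply: leq_trans (leq_add (leq_card_setU _ _).1 (leqnn _)) _.
rewrite !cardsX !cardsT card_prod !card_ord; nia.
Qed.

End Base.

Definition shifted n (p q : grid n) a b c t :=
  [/\ q.1.1 = p.1.1 + t * a :> nat, q.1.2 = p.1.2 + t * b :> nat &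
      q.2 = p.2 + t * c :> nat].

Lemma base_shifted n (p q : grid n) a b c : base a b c p = base a b c q ->
  exists t, shifted p q a b c t \/ shifted q p a b c t.
Proof.
have [px py pz] := baseE a b c p; have [qx qy qz] := baseE a b c q.
move=> pq; rewrite -pq in qx qy qz; rewrite /shifted px py pz qx qy qz.
have [ij|ij] := leqP (steps a b c p) (steps a b c q).
  exists (steps a b c q - steps a b c p); left.
  by split; rewrite -addnA -mulnDl subnKC.
exists (steps a b c p - steps a b c q); right.
by split; rewrite -addnA -mulnDl subnKC // ltnW.
Qed.

(** Distinct points determine the direction: both scalars are the gcd of the coordinate differences,
    and opposite orientations are excluded because all entries are positive. *)
Lemma shifted_primitive n k (p q : grid n) (d d' : 'I_k * 'I_k * 'I_k) t t' :
  p != q -> primitive d -> primitive d' ->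
  shifted p q d.1.1.+1 d.1.2.+1 d.2.+1 t ->
  shifted p q d'.1.1.+1 d'.1.2.+1 d'.2.+1 t' \/
  shifted q p d'.1.1.+1 d'.1.2.+1 d'.2.+1 t' -> d = d'.
Proof.
case: d d' => [[x y] z] [[x' y'] z']; rewrite /primitive /= => pq dp dp' [hx hy hz].
have t0 : 0 < t.
  rewrite lt0n; apply: contraNneq pq => t0; move: hx hy hz; rewrite t0 !mul0n !addn0.
  case: p q => [[? ?] ?] [[? ?] ?] /= hx hy hz.
  by apply/eqP; congr (_, _, _); apply: val_inj.
case=> [[hx' hy' hz']|[hx' hy' hz']]; last by exfalso; nia.
have ex : t * x.+1 = t' * x'.+1 by lia.
have ey : t * y.+1 = t' * y'.+1 by lia.
have ez : t * z.+1 = t' * z'.+1 by lia.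
have tt : t = t'.
  by rewrite -[t]muln1 -(eqP dp) -[t']muln1 -(eqP dp') !muln_gcdr ex ey ez.
subst t'; move: ex ey ez => /eqP; rewrite eqn_pmul2l // => /eqP[ex].
move=> /eqP; rewrite eqn_pmul2l // => /eqP[ey] /eqP; rewrite eqn_pmul2l // => /eqP[ez].
by congr (_, _, _); apply: val_inj.
Qed.

(** The edges are the packed triples of all primitive directions, and [D] counts these directions.
    Triples of one direction are disjoint, which bounds the degrees; those of different directions
    share at most one point, which gives linearity. *)
Lemma grid_hypergraph n k (A : {set grid n}) : 12 * k * (n * n) <= #|A| ->
  exists (E : {set {set grid n}}) D, [/\ [/\ forall e, e \in E -> e \subset A /\ #|e| = 3, linear E &
    forall x, deg E x <= D], D * #|A| <= 6 * #|E|, k ^ 3 <= 2 * D &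
    forall I : {set grid n}, gen_pos I -> indep E I].
Proof.
move=> hA.
have [P hP] := fin_all_exists (fun d : 'I_k * 'I_k * 'I_k => triple_packing
  (@card_base_image n d.1.1.+1 d.1.2.+1 d.2.+1 k A (ltn_ord d.1.1)
    (ltn_ord d.1.2) (ltn_ord d.2))).
pose Dr := [set d | @primitive k d].
pose E := \bigcup_(d in Dr) P d.
have twoP d d' e e' x y : d \in Dr -> d' \in Dr -> e \in P d -> e' \in P d' ->
    x != y -> x \in e -> y \in e -> x \in e' -> y \in e' -> d = d'.
  rewrite !inE => dD dD' eP eP' xy xe ye xe' ye'.
  have [p1 _ _] := hP d; have [_ _ /(_ x y xe ye) fe] := p1 e eP.
  have [p1' _ _] := hP d'; have [_ _ /(_ x y xe' ye') fe'] := p1' e' eP'.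
  have [t [h|h]] := base_shifted fe; have [t' h'] := base_shifted fe'.
    exact: shifted_primitive xy dD dD' h h'.
  rewrite eq_sym in xy; apply: (shifted_primitive (t' := t') xy dD dD' h).
  by case: h' => h'; [right|left].
have big (e : {set grid n}) (e3 : #|e| = 3) : exists x y : grid n, [/\ x != y, x \in e & y \in e].
  have /card_gt1P[x [y [xe ye xy]]] : 1 < #|e| by rewrite e3.
  by exists x, y.
have cE : \sum_(d in Dr) #|P d| <= #|E|.
  apply: (@leq_trans (\sum_(d in Dr) \sum_(e in E) (e \in P d : nat))).
    apply: leq_sum => d dD; rewrite -sum1_card big_mkcond [X in _ <= X]big_mkcond /=.
    apply: leq_sum => e _; case: ifP => // eP.
    by have -> : e \in E by apply/bigcupP; exists d.
  rewrite exchange_big -sum1_card; apply: leq_sum => e /bigcupP[d0 _ eP0] /=.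
  rewrite (_ : \sum_(d in Dr) _ = #|[set d in Dr | e \in P d]|); last first.
    rewrite -sum1_card big_mkcond [RHS]big_mkcond /=; apply: eq_bigr => d _.
    by rewrite !inE; case: (primitive d); case: (e \in P d).
  apply/card_le1_eqP => d d'; rewrite [d \in _]inE [d' \in _]inE => /andP[dD eP] /andP[dD' eP'].
  have [p1 _ _] := hP d0; have [_ e3 _] := p1 e eP0.
  have [x [y [xy xe ye]]] := big e e3.
  exact: (twoP d' d e e x y).
exists E, #|Dr|; split; first split.
- move=> e /bigcupP[d _ eP]; have [p1 _ _] := hP d.
  by have [? ? _] := p1 e eP.
- move=> e e' x y /bigcupP[d dD eP] /bigcupP[d' dD' eP'] xy xe ye xe' ye'.
  have dd' := twoP d d' e e' x y dD dD' eP eP' xy xe ye xe' ye'; subst d'.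
  have [_ p2 _] := hP d; exact: p2 eP eP' xe xe'.
- move=> x; rewrite -sum1_card.
  apply: (@leq_trans (\sum_(d in Dr) deg (P d) x)); last first.
    apply: leq_sum => d _; apply/card_le1_eqP => e e'.
    rewrite !inE => /andP[eP xe] /andP[eP' xe'].
    by have [_ p2 _] := hP d; apply: p2 eP' eP xe' xe.
  rewrite /deg.
  have -> : [set e in E | x \in e] = \bigcup_(d in Dr) [set e in P d | x \in e].
    apply/setP => e; rewrite inE; apply/andP/bigcupP => [[/bigcupP[d dD eP] xe]|].
      by exists d; rewrite // inE eP.
    case=> d dD; rewrite inE => /andP[eP xe]; split=> //.
    by apply/bigcupP; exists d.
  elim/big_rec2: _ => [|d s S _ IH]; first by rewrite cards0.
  by apply: leq_trans (leq_card_setU _ _).1 _; rewrite leq_add2l.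
(* For each direction the packing misses at most 6kn^2 <= |A|/2 points. *)
- apply: leq_trans (leq_mul (leqnn 6) cE).
  rewrite big_distrr /= -sum_nat_const; apply: leq_sum => d _.
  have aux a K p : 12 * K <= a -> a <= 3 * p + 2 * (3 * K) -> a <= 6 * p by lia.
  by have [_ _ p3] := hP d; apply: (aux _ (k * (n * n))); rewrite !mulnA in hA p3 *.
- exact: card_primitive.
move=> I gI e /bigcupP[d _ eP]; have [p1 _ _] := hP d; have [_ e3 ef] := p1 e eP.
have /card_gt2P[x [y [z [[xe ye ze] [xy yz zx]]]]] : 2 < #|e| by rewrite e3.
apply/negP => /subsetP eI.
move: gI => /forall_inP/(_ x (eI _ xe))/forall_inP/(_ y (eI _ ye)).
move=> /forall_inP/(_ z (eI _ ze))/implyP/(_ _)/negP[].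
  by rewrite /= !inE negb_or xy yz eq_sym zx.
by apply: (@coll_base _ d.1.1.+1 d.1.2.+1 d.2.+1); apply: ef.
Qed.

(** * Containers for grid sets in general position *)

Lemma bernoulli m j : m ^ j.+1 + j.+1 * m ^ j <= m.+1 ^ j.+1.
Proof.
elim: j => [|j IH]; first by rewrite !expn1 expn0 mul1n addn1.
rewrite (expnS m.+1) (leq_trans _ (leq_mul (leqnn m.+1) IH)) //.
by rewrite !(expnS m) mulnDr; move: (m ^ j) => M; nia.
Qed.

(** Bernoulli gives (m+1)^(m+1) >= 2 m^(m+1). For m = 999, a thousand rounds of shrinking at least
    halve a set. *)
Lemma double_pow m s : 0 < m -> 2 ^ s * m ^ (m.+1 * s) <= m.+1 ^ (m.+1 * s).
Proof.
move=> m0; rewrite !expnM -expnMn.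
case: s => // s; rewrite leq_exp2r //.
apply: leq_trans (bernoulli m m).
by rewrite mul2n -addnn leq_add2l expnS leq_mul2r leqnSn orbT.
Qed.

Lemma card_grid n : #|{: grid n}| = n ^ 3.
Proof. by rewrite !card_prod !card_ord !expnS expn0 muln1 mulnA. Qed.

(** Here t = x^5 b, and [k] is the largest range of directions that supersaturation permits for
    [A]. *)
Lemma grid_containers_step x b (A : {set grid (x ^ 3)}) :
  100 <= b -> b <= x -> x ^ 8 * b <= #|A| ->
  exists L : seq {set grid (x ^ 3)}, [/\ size L <= (x ^ 9).+1 ^ (2 * (x ^ 5 * b)),
    forall C, C \in L -> 1000 * #|C| <= 999 * #|A| &
    forall I : {set grid (x ^ 3)}, I \subset A -> gen_pos I -> exists2 C, C \in L & I \subset C].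
Proof.
move=> b100 bx hA; set a := #|A| in hA.
have x0 : 0 < x by lia.
have aN : a <= x ^ 9.
  by rewrite (leq_trans (max_card _)) // card_grid -expnM.
pose k := a %/ (12 * x ^ 6).
have d0 : 0 < 12 * x ^ 6 by rewrite muln_gt0 expn_gt0 x0.
have kx : x ^ 2 <= k.
  rewrite leq_divRL // (leq_trans _ hA) // mulnCA -expnD mulnC leq_mul2l; lia.
have ka : 12 * k * (x ^ 3 * x ^ 3) <= a.
  by rewrite -expnD -mulnA (mulnC k) mulnA mulnC leq_divM.
have ak : a < 24 * x ^ 6 * k.
  have : a < k.+1 * (12 * x ^ 6) by rewrite -ltn_divLR.
  have : 0 < k by rewrite (leq_trans _ kx) // expn_gt0 x0.
  clear; nia.
have [E [D [[e1 e2 e3] e4 e5 e6]]] := grid_hypergraph ka.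
have x2 : 2000 <= x ^ 2 by rewrite expnS expn1; nia.
have c1 : 2000 * (x ^ 5 * b) <= a.
  apply: leq_trans hA; rewrite (_ : 8 = 5 + 3) // expnD mulnCA -mulnA leq_mul2l.
  apply/orP; right; rewrite leq_mul2r; apply/orP; right.
  by rewrite (leq_trans _ (leq_pexp2l x0 (isT : 2 <= 3))) //; lia.
have c2 : 0 < a <= D * (x ^ 5 * b).
  apply/andP; split; first by rewrite (leq_trans _ hA) // muln_gt0 expn_gt0 x0; lia.
  have h1 : x ^ 2 * x ^ 2 * k <= 2 * D.
    by apply: leq_trans e5; rewrite (expnSr k 2) (expnS k 1) expn1 leq_mul // leq_mul.
  have h2 : x ^ 6 <= x ^ 2 * x ^ 2 * x ^ 5 by rewrite -!expnD leq_pexp2l.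
  have h3 : 48 * x ^ 6 * k <= x ^ 2 * x ^ 2 * x ^ 5 * b * k.
    rewrite leq_mul2r mulnC leq_mul ?orbT //; lia.
  have h4 : x ^ 2 * x ^ 2 * k * (x ^ 5 * b) <= 2 * D * (x ^ 5 * b) by rewrite leq_mul2r h1 orbT.
  move: h3 h4 ak; clear.
  move: (x ^ 2 * x ^ 2) (x ^ 5) (x ^ 6) => X Y Z h3 h4 ak.
  have h5 : X * Y * b * k = X * k * (Y * b) by lia.
  by rewrite -h5 in h4; move: (X * Y * b * k) h3 h4 => W h3 h4; lia.
have c3 : 4 * a * a < x ^ 5 * b * (x ^ 5 * b) * D.
  have h0 : a * a < (24 * x ^ 6 * k) * (24 * x ^ 6 * k) by rewrite ltn_mul.
  have h1 : x ^ 2 * (k * k) <= 2 * D.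
    by apply: leq_trans e5; rewrite (expnS k 2) (expnS k 1) expn1 leq_mul.
  have h2 : x ^ 5 * x ^ 5 * x ^ 2 = x ^ 6 * x ^ 6 by rewrite -!expnD.
  (* 4608 = 4 * 24^2 * 2, from 4a^2, a < 24 x^6 k and k^3 <= 2D. *)
  have h3 : 4608 <= b * b by nia.
  have h4 : 4608 * (x ^ 6 * x ^ 6 * (k * k)) <= b * b * (x ^ 6 * x ^ 6 * (k * k)).
    by rewrite leq_mul2r h3 orbT.
  have h5 : x ^ 5 * b * (x ^ 5 * b) * (x ^ 2 * (k * k)) <= x ^ 5 * b * (x ^ 5 * b) * (2 * D).
    by rewrite leq_mul2l h1 orbT.
  move: h0 h2 h4 h5; clear.
  move: (x ^ 5) (x ^ 6) (x ^ 2) => X Y Z h0 h2 h4 h5.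
  have h6 : b * b * (Y * Y * (k * k)) = X * b * (X * b) * (Z * (k * k)).
    by rewrite -h2; lia.
  lia.
have [L [l1 l2 l3]] := linear_containers e1 e2 e3 e4 c1 c2 c3.
exists L; split=> //; last by move=> I IA /e6; apply: l3.
apply: leq_trans l1 _; rewrite leq_exp2r //.
by rewrite muln_gt0 muln_gt0 expn_gt0 x0; lia.
Qed.

(** The 9000ub rounds shrink sizes by a factor of at least 2^(9ub) >= b^(9u), the number of grid
    points. *)
Lemma grid_containers u b : 0 < u -> 100 <= b ->
  exists L : seq {set grid ((b ^ u) ^ 3)}, [/\
    size L <= (b ^ (9 * u)).+1 ^ (2 * b ^ (5 * u).+1 * (1000 * 9 * u * b)),
    forall C, C \in L -> #|C| < b ^ (8 * u).+1 &
    forall I : {set grid ((b ^ u) ^ 3)}, gen_pos I -> exists2 C, C \in L & I \subset C].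
Proof.
move=> u0 b100.
have bx : b <= b ^ u by rewrite -{1}(expn1 b) leq_pexp2l //; lia.
have b0 : 0 < b by lia.
have x0 : 0 < b ^ u by rewrite expn_gt0 b0.
have E8 : b ^ (8 * u).+1 = (b ^ u) ^ 8 * b by rewrite expnSr -expnM (mulnC u).
have E5 : b ^ (5 * u).+1 = (b ^ u) ^ 5 * b by rewrite expnSr -expnM (mulnC u).
have E9 : b ^ (9 * u) = (b ^ u) ^ 9 by rewrite -expnM mulnC.
rewrite E8 E5 E9.
have [||L [l1 l2 l3]] := iterate_containers
  (fun A hA => grid_containers_step b100 bx hA) _
  (j := 1000 * 9 * u * b) (A := setT).
- by rewrite expn_gt0.
- rewrite cardsT card_grid -expnM -E9 (_ : 1000 * 9 * u * b = 1000 * (9 * u * b)); last by lia.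
  apply: (@leq_ltn_trans (1000 ^ (1000 * (9 * u * b)))); last first.
    rewrite -{1}(mul1n (1000 ^ _)) ltn_pmul2r ?expn_gt0 //.
    by rewrite (@leq_trans b) // ?(leq_trans _ b100) // leq_pmull // expn_gt0 x0.
  apply: leq_trans (@double_pow 999 (9 * u * b) isT).
  rewrite leq_mul2r; apply/orP; right.
  rewrite [9 * u * b]mulnC (expnM 2).
  by rewrite leq_exp2r ?muln_gt0 // ltnW // ltn_expl.
exists L; split=> //; first by rewrite expnM.
by move=> I gI; apply: l3 => //; apply: subsetT.
Qed.

(** * Collinear quadruples of the grid *)

(** [v] is [u] divided by the gcd of its entries. A Bezout combination of the entries of [v] equals
    1; the same combination of the entries of [w] is the factor [j]. *)
Lemma primitive_direction (u1 u2 u3 : Z) : (u1 <> 0 \/ u2 <> 0 \/ u3 <> 0)%Z ->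
  exists v1 v2 v3 g : Z, (u1 = g * v1 /\ u2 = g * v2 /\ u3 = g * v3)%Z /\
  forall w1 w2 w3 : Z, (u1 * w2 = u2 * w1)%Z -> (u1 * w3 = u3 * w1)%Z ->
    (u2 * w3 = u3 * w2)%Z ->
    exists j : Z, (w1 = j * v1 /\ w2 = j * v2 /\ w3 = j * v3)%Z.
Proof.
move=> u0; set h := Z.gcd u1 u2; set g := Z.gcd h u3.
have [a [b hab]] : Z.Bezout u1 u2 h by apply: Z.gcd_bezout.
have [c [d hcd]] : Z.Bezout h u3 g by apply: Z.gcd_bezout.
have gh : (g | h)%Z by apply: Z.gcd_divide_l.
have [v3 e3] : (g | u3)%Z by apply: Z.gcd_divide_r.
have [v1 e1] : (g | u1)%Z by apply: Z.divide_trans gh (Z.gcd_divide_l _ _).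
have [v2 e2] : (g | u2)%Z by apply: Z.divide_trans gh (Z.gcd_divide_r _ _).
clearbody g h; clear gh.
have g0 : g <> 0%Z by move=> g0; rewrite g0 in e1 e2 e3; lia.
exists v1, v2, v3, g; split; first by lia.
move=> w1 w2 w3 h12 h13 h23.
have one : (c * a * v1 + c * b * v2 + d * v3 = 1)%Z.
  apply: (Z.mul_reg_l _ _ g g0).
  rewrite -{2}hcd -hab.
  transitivity (c * (a * (v1 * g) + b * (v2 * g)) + d * (v3 * g))%Z; first by lia.
  by rewrite -e1 -e2 -e3; lia.
have k12 : (v1 * w2 = v2 * w1)%Z by apply: (Z.mul_reg_l _ _ g g0); rewrite e1 e2 in h12; lia.
have k13 : (v1 * w3 = v3 * w1)%Z by apply: (Z.mul_reg_l _ _ g g0); rewrite e1 e3 in h13; lia.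
have k23 : (v2 * w3 = v3 * w2)%Z by apply: (Z.mul_reg_l _ _ g g0); rewrite e2 e3 in h23; lia.
exists (c * a * w1 + c * b * w2 + d * w3)%Z; split; [|split].
- transitivity ((c * a * v1 + c * b * v2 + d * v3) * w1)%Z; first by rewrite one; lia.
  transitivity (c * a * v1 * w1 + c * b * (v2 * w1) + d * (v3 * w1))%Z; first by lia.
  by rewrite -k12 -k13; lia.
- transitivity ((c * a * v1 + c * b * v2 + d * v3) * w2)%Z; first by rewrite one; lia.
  transitivity (c * a * (v1 * w2) + c * b * v2 * w2 + d * (v3 * w2))%Z; first by lia.
  by rewrite k12 -k23; lia.
transitivity ((c * a * v1 + c * b * v2 + d * v3) * w3)%Z; first by rewrite one; lia.
transitivity (c * a * (v1 * w3) + c * b * (v2 * w3) + d * v3 * w3)%Z; first by lia.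
by rewrite k13 k23; lia.
Qed.

Definition quads n : {set grid n * grid n * grid n * grid n} :=
  [set x : grid n * grid n * grid n * grid n |
    [&& uniq [:: x.1.1.1; x.1.1.2; x.1.2; x.2], coll x.1.1.1 x.1.1.2 x.1.2
      & coll x.1.1.1 x.1.1.2 x.2]].

(** Negative sums become 0 and sums beyond the range give back [i]; the covering of [quads] relies
    only on shifts that stay in range. *)
Definition ord_shift n (i : 'I_n) (z : Z) : 'I_n := insubd i (Z.to_nat (Z.of_nat i + z)).

Lemma ord_shiftE n (i j : 'I_n) z : (Z.of_nat j - Z.of_nat i = z)%Z -> ord_shift i z = j.
Proof.
move=> h; rewrite /ord_shift (_ : Z.to_nat _ = j); last by lia.
by apply: val_inj; rewrite val_insubd ltn_ord.
Qed.

Definition grid_shift n (p : grid n) (v1 v2 v3 z : Z) : grid n :=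
  (ord_shift p.1.1 (z * v1), ord_shift p.1.2 (z * v2), ord_shift p.2 (z * v3)).

(* Elements of ['I_(2 * m)] stand for the integers in [-m, m). *)
Definition signed m (i : 'I_(2 * m)) : Z := (Z.of_nat i - Z.of_nat m)%Z.

Lemma signed_surj m (z : Z) : (Z.abs z < Z.of_nat m)%Z -> exists i, @signed m i = z.
Proof.
move=> hz; have h : Z.to_nat (z + Z.of_nat m) < 2 * m by lia.
by exists (Ordinal h); rewrite /signed /=; lia.
Qed.

Definition quad_of n s t (x : grid n * grid (2 * s) * grid (2 * t)) :
    grid n * grid n * grid n * grid n :=
  let mv := grid_shift x.1.1 (signed x.1.2.1.1) (signed x.1.2.1.2) (signed x.1.2.2) in
  (x.1.1, mv (signed x.2.1.1), mv (signed x.2.1.2), mv (signed x.2.2)).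

Lemma Zabs_mul_lt (i v : Z) (m n B T : nat) : (Z.abs (i * v) < Z.of_nat n)%Z ->
  Z.abs v = Z.of_nat m -> B <= m -> T * B = n -> (Z.abs i < Z.of_nat T)%Z.
Proof.
move=> h1 h2 h3 h4; rewrite Z.abs_mul h2 -h4 in h1.
have {}h1 : (Z.abs_nat i) * m < T * B by lia.
have : Z.abs_nat i * B < T * B.
  by apply: leq_ltn_trans h1; rewrite leq_mul2l h3 orbT.
by rewrite ltn_mul2r => /andP[_]; lia.
Qed.

Lemma coord_diff_lt n (p w : grid n) : [/\ (Z.abs (cx w - cx p) < Z.of_nat n)%Z,
  (Z.abs (cy w - cy p) < Z.of_nat n)%Z & (Z.abs (cz w - cz p) < Z.of_nat n)%Z].
Proof.
have aux (i j : 'I_n) : (Z.abs (Z.of_nat i - Z.of_nat j) < Z.of_nat n)%Z.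
  by have := ltn_ord i; have := ltn_ord j; lia.
by split; apply: aux.
Qed.

(** A quadruple is coded by a point, a primitive direction and three multipliers. If the direction
    has maximum norm in [b^l, b^(l+1)), the multipliers are below b^(L-l) in absolute value, so each
    of the [L] values of [l] needs 64 b^(6L+3) codes. *)
Lemma card_quads b L : 1 < b ->
  #|quads (b ^ L)| <= 64 * L * b ^ (6 * L + 3).
Proof.
move=> b1; set n := b ^ L.
pose F (l : 'I_L) := [set quad_of x | x : grid n * grid (2 * b ^ l.+1) * grid (2 * b ^ (L - l))].
have sub : quads n \subset \bigcup_(l < L) F l.
  apply/subsetP => -[[[p q] r] s]; rewrite inE /= => /and3P[un cr cs].
  have pq : p != q by move: un; rewrite !inE negb_or -andbA => /andP[].
  pose u1 := (cx q - cx p)%Z; pose u2 := (cy q - cy p)%Z; pose u3 := (cz q - cz p)%Z.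
  have u0 : (u1 <> 0 \/ u2 <> 0 \/ u3 <> 0)%Z.
    have [e1|e1] := Z.eq_dec u1 0; last by left.
    have [e2|e2] := Z.eq_dec u2 0; last by right; left.
    right; right=> e3; case/eqP: pq; move: e1 e2 e3; rewrite /u1 /u2 /u3 /cx /cy /cz.
    case: (p) (q) => [[? ?] ?] [[? ?] ?] /= e1 e2 e3.
    by congr (_, _, _); apply: val_inj; rewrite /=; lia.
  have [v1 [v2 [v3 [i [[i1 [i2 i3]] hv]]]]] := primitive_direction u0.
  have dir w : coll p q w -> exists j, (cx w - cx p = j * v1 /\ cy w - cy p = j * v2
      /\ cz w - cz p = j * v3)%Z.
    by move=> /and3P[/Z.eqb_spec h1 /Z.eqb_spec h2 /Z.eqb_spec h3]; apply: hv.
  have [j [j1 [j2 j3]]] := dir r cr; have [k [k1 [k2 k3]]] := dir s cs.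
  have bnd w := coord_diff_lt p w.
  pose m := maxn (Z.abs_nat v1) (maxn (Z.abs_nat v2) (Z.abs_nat v3)).
  have m0 : 0 < m.
    rewrite lt0n; apply/eqP => m0.
    have [z1 [z2 z3]] : (v1 = 0 /\ v2 = 0 /\ v3 = 0)%Z by move: m0; rewrite /m; clear; lia.
    by move: u0; rewrite i1 i2 i3 z1 z2 z3; clear; lia.
  have i0 : i <> 0%Z by move=> i0; move: u0; rewrite i1 i2 i3 i0; clear; lia.
  have mE : [\/ Z.abs v1 = Z.of_nat m, Z.abs v2 = Z.of_nat m | Z.abs v3 = Z.of_nat m].
    have : Z.abs v1 = Z.of_nat m \/ Z.abs v2 = Z.of_nat m
      \/ Z.abs v3 = Z.of_nat m by rewrite /m; clear; lia.
    by case=> [|[]]; [constructor 1|constructor 2|constructor 3].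
  have mle : [/\ (Z.abs v1 <= Z.of_nat m)%Z, (Z.abs v2 <= Z.of_nat m)%Z &
     (Z.abs v3 <= Z.of_nat m)%Z] by rewrite /m; clear; split; lia.
  have small (z : Z) (w : grid n) : (cx w - cx p = z * v1)%Z -> (cy w - cy p = z * v2)%Z ->
      (cz w - cz p = z * v3)%Z -> forall B T, B <= m -> T * B = n ->
      (Z.abs z < Z.of_nat T)%Z.
    have [w1 w2 w3] := bnd w.
    move=> z1 z2 z3 B T Bm TB; rewrite z1 in w1; rewrite z2 in w2; rewrite z3 in w3.
    by case: mE => mE; apply: Zabs_mul_lt mE Bm TB; eassumption.
  have [bl bl'] := andP (trunc_log_bounds b1 m0); set l := trunc_log b m in bl bl'.
  (* [i * v] is a difference of grid points with [i] nonzero, so the norm of [v] is below [n]; this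
     gives [l < L]. *)
  have mn : m < n.
    have := small i q i1 i2 i3 1 n m0 (muln1 n).
    have [q1 q2 q3] := bnd q; rewrite -/u1 i1 in q1; rewrite -/u2 i2 in q2.
    rewrite -/u3 i3 in q3; move: i0 q1 q2 q3 mE; clear => i0 q1 q2 q3 mE _.
    have i1 : (1 <= Z.abs i)%Z by lia.
    by case: mE => mE; [move: q1|move: q2|move: q3]; rewrite Z.abs_mul mE => h;
      have := Z.mul_le_mono_nonneg_r 1 (Z.abs i) _ (Zle_0_nat m) i1; lia.
  have lL : l < L by rewrite -(ltn_exp2l _ _ b1) (leq_ltn_trans bl).
  apply/bigcupP; exists (Ordinal lL) => //.
  have TB : b ^ (L - l) * b ^ l = n by rewrite -expnD subnK // ltnW.
  have lt (z : Z) (w : grid n) h1 h2 h3 := signed_surj (small z w h1 h2 h3 (b ^ l) _ bl TB).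
  have [i' ei] := lt i q i1 i2 i3; have [j' ej] := lt j r j1 j2 j3.
  have [k' ek] := lt k s k1 k2 k3.
  have vs v : (Z.abs v <= Z.of_nat m)%Z -> (Z.abs v < Z.of_nat (b ^ l.+1))%Z.
    by move: bl'; clear; move: (b ^ l.+1) => N; lia.
  case: mle => /vs/signed_surj[v1' e1] /vs/signed_surj[v2' e2] /vs/signed_surj[v3' e3].
  apply/imsetP; exists (p, (v1', v2', v3'), (i', j', k')) => //.
  rewrite /quad_of /= e1 e2 e3 ei ej ek /grid_shift.
  move: i1 i2 i3 j1 j2 j3 k1 k2 k3; rewrite /u1 /u2 /u3 /cx /cy /cz.
  move=> /ord_shiftE-> /ord_shiftE-> /ord_shiftE-> /ord_shiftE-> /ord_shiftE->.
  move=> /ord_shiftE-> /ord_shiftE-> /ord_shiftE-> /ord_shiftE->.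
  by rewrite -!surjective_pairing.
apply: leq_trans (subset_leq_card sub) _.
apply: (@leq_trans (\sum_(l < L) 64 * b ^ (6 * L + 3))); last first.
  by rewrite sum_nat_const card_ord mulnCA mulnA.
elim/big_rec2: _ => [|l t S _ IH]; first by rewrite cards0.
apply: leq_trans (leq_card_setU _ _).1 _; rewrite leq_add //.
apply: leq_trans (leq_imset_card _ _) _.
rewrite !card_prod !card_ord /n.
have -> : b ^ (6 * L + 3) = (b ^ L * b ^ L * b ^ L) *
    (b ^ l.+1 * b ^ l.+1 * b ^ l.+1) * (b ^ (L - l) * b ^ (L - l) * b ^ (L - l)).
  rewrite -!expnD; congr (_ ^ _); have := ltn_ord l; lia.
move: (b ^ L) (b ^ l.+1) (b ^ (L - l)) => X Y Z; lia.
Qed.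

(** * Random subsets *)

Section RandomSubset.
Variables (V : finType) (q : nat).
Notation fT := {ffun V -> 'I_q.+1}.

Definition zeros (f : fT) := [set x | f x == ord0].

Lemma card_zeros (T : {set V}) :
  #|[set f | T \subset zeros f]| * q.+1 ^ #|T| = q.+1 ^ #|V|.
Proof.
have -> : #|[set f : fT | T \subset zeros f]| = q.+1 ^ #|~: T|.
  have := card_pffun_on (ord0 : 'I_q.+1) (mem (~: T)) predT; rewrite card_ord => <-.
  rewrite cardsE; apply: eq_card => f; apply/idP/idP.
    move=> /subsetP h; apply/pffun_onP; split=> //.
    apply/supportP => x; rewrite inE negbK => /h; rewrite inE => /eqP->.
    by [].
  move=> /pffun_onP[/supportP h _]; apply/subsetP => x xT; rewrite inE.
  by apply/eqP; apply: h; rewrite inE negbK.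
by rewrite -expnD addnC cardsC.
Qed.

Lemma sum_zeros (J : finType) (P : {set J}) (T : J -> {set V}) m :
  (forall x, x \in P -> #|T x| = m) ->
  (\sum_(f : fT) #|[set x in P | T x \subset zeros f]|) * q.+1 ^ m
    = #|P| * q.+1 ^ #|V|.
Proof.
move=> hT.
transitivity (\sum_(x in P) #|[set f : fT | T x \subset zeros f]| * q.+1 ^ m).
  rewrite -big_distrl /=; congr (_ * _).
  transitivity (\sum_(f : fT) \sum_(x in P) (T x \subset zeros f : nat)).
    apply: eq_bigr => f _; rewrite -sum1_card big_mkcond [RHS]big_mkcond /=.
    by apply: eq_bigr => x _; rewrite inE; case: (x \in P); case: (_ \subset _).
  rewrite exchange_big; apply: eq_bigr => x _ /=.
  rewrite -sum1_card [RHS]big_mkcond /=.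
  by apply: eq_bigr => f _; rewrite inE; case: (_ \subset _).
by rewrite -sum_nat_const; apply: eq_bigr => x xP; rewrite -(hT x xP) card_zeros.
Qed.

(* The first moment method for a random subset of density [1 / q.+1], followed by
   the deletion of one point from each surviving tuple of [Q]. *)
Lemma random_subset (J : finType) (Q : {set J}) (T : J -> {set V}) (pt : J -> V)
    (F : {set {set V}}) m s k :
  (forall x, x \in Q -> #|T x| = k.+1 /\ pt x \in T x) ->
  (forall I, I \in F -> #|I| = m) -> 0 < s -> 4 * s * q.+1 <= #|V| ->
  4 * #|Q| <= #|V| * q.+1 ^ k -> 4 * #|F| * q.+1 <= q.+1 ^ m ->
  exists S : {set V}, [/\ s <= #|S|, forall x, x \in Q -> ~~ (T x \subset S) &
    forall I, I \in F -> ~~ (I \subset S)].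
Proof.
move=> hQ hF s0 hs cQ cF; set N := #|V|.
pose W (f : fT) := [set x in Q | T x \subset zeros f].
pose Y (f : fT) := [set I in F | I \subset zeros f].
(* With r = q.+1, the mean of |zeros f| is N/r, while [s] and the means of |W f| and N|Y f| are at
   most N/(4r) each. *)
have [f hf] : exists f : fT, s + #|W f| + N * #|Y f| <= #|zeros f|.
  case: (pickP (fun f : fT => s + #|W f| + N * #|Y f| <= #|zeros f|)) => [f hf|no].
    by exists f.
  exfalso.
  have h0 : \sum_(f : fT) #|zeros f| <= \sum_(f : fT) (s + #|W f| + N * #|Y f|).
    by apply: leq_sum => f _; have /negbT := no f; rewrite -ltnNge => /ltnW.
  have h1 : (\sum_(f : fT) #|zeros f|) * q.+1 = N * q.+1 ^ N.
    have := @sum_zeros V setT set1 1 (fun x _ => cards1 x); rewrite cardsT expn1 => <-.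
    congr (_ * _); apply: eq_bigr => f _; apply: eq_card => x.
    by rewrite !inE sub1set inE.
  have h2 := sum_zeros (fun x xQ => (hQ x xQ).1).
  have h3 := @sum_zeros _ F id m hF.
  rewrite !big_split /= -big_distrr /= sum_nat_const card_ffun card_ord in h0.
  rewrite -/N in h0 h2 h3 hs cQ.
  set SZ := \sum_(f : fT) #|zeros f| in h0 h1.
  set SW := \sum_(f : fT) #|W f| in h0.
  set SY := \sum_(f : fT) #|Y f| in h0.
  rewrite -[\sum_(f : fT) _]/SW in h2; rewrite -[\sum_(f : fT) _]/SY in h3.
  have qk : 0 < q.+1 ^ k by rewrite expn_gt0.
  have qm : 0 < q.+1 ^ m by rewrite expn_gt0.
  have qN : 0 < q.+1 ^ N by rewrite expn_gt0.
  have N0 : 0 < N by nia.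
  rewrite expnS in h2.
  move: (q.+1 ^ k) (q.+1 ^ m) (q.+1 ^ N) qk qm qN h0 h1 h2 h3 cQ cF => K M P K0 M0 P0.
  move: (q.+1) hs => r hs h0 h1 h2 h3 cQ cF.
  have g1 : 4 * r * SW <= N * P.
    rewrite -(leq_pmul2r K0).
    have -> : 4 * r * SW * K = 4 * #|Q| * P by rewrite -[RHS]mulnA -h2; lia.
    by rewrite [N * P * K]mulnAC leq_mul2r cQ orbT.
  have g2 : 4 * r * SY <= P.
    rewrite -(leq_pmul2r M0).
    have -> : 4 * r * SY * M = 4 * #|F| * r * P by rewrite -[RHS]mulnA [r * P]mulnC mulnA -[4 * _ * P]mulnA -h3; lia.
    by rewrite mulnC leq_mul2l cF orbT.
  have g3 : 4 * r * (P * s) <= N * P.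
    have -> : 4 * r * (P * s) = 4 * s * r * P by lia.
    by rewrite leq_mul2r hs orbT.
  have g4 : N * (4 * r * SY) <= N * P by rewrite leq_mul2l g2 orbT.
  have g5 : 4 * r * SZ <= 4 * r * (P * s + SW + N * SY) by rewrite leq_mul2l h0 orbT.
  have g6 : 4 * r * SZ = 4 * (N * P) by rewrite -h1; lia.
  have g7 : 0 < N * P by rewrite muln_gt0 N0.
  have g8 : 4 * r * (P * s + SW + N * SY) = 4 * r * (P * s) + 4 * r * SW + N * (4 * r * SY).
    by lia.
  move: g1 g3 g4 g5 g6 g7 g8; clear; lia.
have zN : #|zeros f| <= N by apply: max_card.
(* A member of [Y f] would give s + N <= N. *)
have Y0 : Y f = set0.
  by apply/eqP; rewrite -cards_eq0; case: #|Y f| hf => //; nia.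
pose S := zeros f :\: [set pt x | x in W f].
exists S; split.
- have := cardsD (zeros f) [set pt x | x in W f]; rewrite -/S => ->.
  rewrite leq_subRL ?subset_leq_card ?subsetIl // addnC.
  apply: leq_trans hf; rewrite -addnA leq_add2l (leq_trans _ (leq_addr _ _)) //.
  by rewrite (leq_trans _ (leq_imset_card pt (W f))) // subset_leq_card // subsetIr.
- move=> x xQ; apply/negP => sub.
  have xW : x \in W f by rewrite inE xQ (subset_trans sub) // subsetDl.
  have := subsetP sub _ (hQ x xQ).2; rewrite inE => /andP[/negP[]].
  by apply: imset_f.
move=> I IF; apply/negP => sub.
have : I \in Y f by rewrite inE IF (subset_trans sub) // subsetDl.
by rewrite Y0 inE.
Qed.

End RandomSubset.

(** * Counting subsets of containers and choosing the parameters *)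

Lemma ffact_le_exp n m : n ^_ m <= n ^ m.
Proof.
elim: m n => [|m IH] n; first by rewrite ffactn0.
rewrite ffactnS expnS leq_mul2l; apply/orP; right.
by apply: leq_trans (IH _) _; case: m {IH} => // m; rewrite leq_exp2r // leq_pred.
Qed.

Lemma exp_le_ffact n m : n ^ m <= (n + m) ^_ m.
Proof.
elim: m => [|m IH]; first by rewrite ffactn0.
by rewrite addnS ffactSS expnS leq_mul // leqW // leq_addr.
Qed.

(** m^m is at most (2m)(2m-1)...(m+1) = C(2m, m) m!, and C(2m, m) <= 4^m. *)
Lemma exp_le_fact m : m ^ m <= 4 ^ m * m`!.
Proof.
apply: leq_trans (exp_le_ffact m m) _.
rewrite -bin_ffact leq_mul2r; apply/orP; right.
have -> : 4 ^ m = 2 ^ (m + m) by rewrite addnn -mul2n expnM.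
rewrite -[2]/(1 + 1) expnDn.
have h : m < (m + m).+1 by rewrite ltnS leq_addr.
by rewrite (bigD1 (Ordinal h)) //= !exp1n !muln1 leq_addr.
Qed.

(** The bound C(N, m) <= (eN/m)^m for N = ym, with 4 in place of e. *)
Lemma bin_le_exp y m : 'C(y * m, m) <= (4 * y) ^ m.
Proof.
have [->|m0] := posnP m; first by rewrite muln0 bin0 expn0.
have mm : 0 < m ^ m by rewrite expn_gt0 m0.
rewrite -(leq_pmul2r mm) (leq_trans (leq_mul (leqnn _) (exp_le_fact m))) //.
by rewrite mulnCA bin_ffact expnMn -mulnA leq_mul2l -expnMn ffact_le_exp orbT.
Qed.

Lemma card_subsets_of_seq (V : finType) (L : seq {set V}) (F : {set {set V}}) K m :
  (forall C, C \in L -> #|C| <= K) ->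
  (forall I, I \in F -> #|I| = m /\ exists2 C, C \in L & I \subset C) ->
  #|F| <= size L * 'C(K, m).
Proof.
elim: L F => [|C L IH] F hL hF.
  have [->|[I /hF[_ []//]]] := set_0Vmem F; by rewrite cards0.
rewrite -(cardsID [set I : {set V} | I \subset C & #|I| == m] F) mulSn leq_add //.
  apply: (@leq_trans 'C(#|C|, m)).
    by rewrite -cards_draws subset_leq_card // subsetIr.
  by apply: leq_bin2l; apply: hL; rewrite inE eqxx.
apply: IH => [D DL|I]; first by apply: hL; rewrite inE DL orbT.
rewrite !inE => /andP[h /hF[Im [D DL ID]]]; split=> //.
exists D => //; move: DL; rewrite inE => /orP[/eqP E|//].
by move: h; rewrite -E ID Im eqxx.
Qed.

Lemma gen_posS n (J I : {set grid n}) : J \subset I -> gen_pos I -> gen_pos J.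
Proof.
move=> /subsetP JI /forall_inP gI; apply/forall_inP => p pJ; apply/forall_inP => q qJ.
apply/forall_inP => r rJ.
by have /forall_inP/(_ q (JI _ qJ))/forall_inP/(_ r (JI _ rJ)) := gI p (JI _ pJ).
Qed.

(** Density 1/q with q = b^(3u+2) leaves b^(6u-2) of the b^(9u) points on average, against at most
    192u b^(6u-5) collinear quadruples. The lower bound on [b] absorbs the factors depending on
    [u]. *)
Lemma grid_no_four_collinear u b : 0 < u ->
  (9 * u + 1) * (2 * (1000 * 9 * u)) + 3 * u + 3 <= b ->
  exists S : {set grid ((b ^ u) ^ 3)}, [/\ b ^ (6 * u - 3) <= #|S|,
    forall x, x \in quads ((b ^ u) ^ 3) ->
      ~~ ([set x.1.1.1; x.1.1.2; x.1.2; x.2] \subset S) &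
    forall I : {set grid ((b ^ u) ^ 3)}, I \subset S -> gen_pos I ->
      #|I| < b ^ (5 * u + 4)].
Proof.
move=> u0 hb; set n := (b ^ u) ^ 3.
have b1000 : 1000 * u <= b.
  apply: leq_trans hb; rewrite -addnA (leq_trans _ (leq_addr _ _)) //.
  rewrite mulnCA (leq_trans _ (leq_mul (isT : 1 <= 2) (leqnn _))) //; nia.
have b0 : 0 < b by lia.
have b100 : 100 <= b by lia.
have b1 : 1 < b by lia.
have b4 : 4 <= b by lia.
pose m := b ^ (5 * u + 4).
pose F := [set I : {set grid n} | gen_pos I && (#|I| == m)].
pose q := b ^ (3 * u + 2).
have q0 : 0 < q by rewrite expn_gt0 b0.
have [L [l1 l2 l3]] := grid_containers u0 b100.
have cF : 4 * #|F| * q <= q ^ m.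
  (* [y * m] is the container size b^(8u+1). Since 4y <= q/b, the union bound gains b^m, which beats
     the number of containers, whose exponent is of order b^(5u+2). *)
  pose y := b ^ (3 * u - 3).
  have hF : #|F| <= size L * (4 * y) ^ m.
    apply: leq_trans (leq_mul (leqnn _) (bin_le_exp y m)).
    apply: card_subsets_of_seq => [C /l2/ltnW|I].
      by rewrite (_ : y * m = b ^ (8 * u).+1) // -expnD; congr (_ ^ _); lia.
    by rewrite inE => /andP[/l3 h /eqP].
  have hL : 4 * q * size L <= b ^ m.
    have e1 : 4 * q <= b ^ (3 * u + 3).
      by rewrite (addnS _ 2) expnS leq_mul.
    have e2 : size L <= b ^ ((9 * u + 1) * (2 * (1000 * 9 * u)) * b ^ (5 * u + 2)).
      apply: leq_trans l1 _.
      rewrite (_ : 2 * b ^ (5 * u).+1 * _ = 2 * (1000 * 9 * u) * b ^ (5 * u + 2)).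
        rewrite -[X in _ <= b ^ X]mulnA (expnM b (9 * u + 1)) leq_exp2r.
          rewrite addn1 expnS (leq_trans _ (leq_mul b1 (leqnn _))) // mul2n -addnn.
          by rewrite -add1n leq_add2r expn_gt0 b0.
        by rewrite !muln_gt0 expn_gt0 b0 u0.
      by rewrite addn2 (expnS b (5 * u).+1); move: (b ^ _) => B; lia.
    apply: leq_trans (leq_mul e1 e2) _; rewrite -expnD leq_exp2l //.
    rewrite /m (_ : 5 * u + 4 = 5 * u + 2 + 2); last by lia.
    rewrite (expnD _ (5 * u + 2)); set w := b ^ (5 * u + 2).
    have w0 : 0 < w by rewrite expn_gt0 b0.
    apply: (@leq_trans (w * b)); last by rewrite leq_mul2l expnS leq_pmulr ?orbT ?expn_gt0 ?b0.
    rewrite (leq_trans _ (leq_mul (leqnn w) hb)) //.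
    set X := (9 * u + 1) * _.
    by rewrite -(addnA X) mulnDr addnC (mulnC X) leq_add2l leq_pmull.
  have hq : b * (4 * y) <= q.
    rewrite mulnCA -expnS (leq_trans (leq_mul b4 (leqnn _))) //.
    by rewrite -expnS leq_exp2l //; clear -u0; lia.
  apply: (@leq_trans ((b * (4 * y)) ^ m)); last first.
    by rewrite leq_exp2r // expn_gt0 b0.
  rewrite expnMn (leq_trans _ (leq_mul hL (leqnn _))) //.
  by rewrite mulnAC -[X in _ <= X]mulnA leq_mul2l hF orbT.
have qE : q = q.-1.+1 by rewrite prednK.
have cV : #|{: grid n}| = b ^ (9 * u) by rewrite card_grid /n -!expnM; congr (_ ^ _); lia.
have [] := @random_subset (grid n : finType) q.-1 _ (quads n)
  (fun x => [set x.1.1.1; x.1.1.2; x.1.2; x.2]) (fun x => x.1.1.1) F m (b ^ (6 * u - 3)) 3.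
- move=> [[[p1 p2] p3] p4]; rewrite inE => /and3P[un _ _]; split; last by rewrite !inE eqxx.
  have /card_uniqP/= <- := un.
  by apply: eq_card => x; rewrite !inE -!orbA.
- by move=> I; rewrite inE => /andP[_ /eqP].
- by rewrite expn_gt0 b0.
- rewrite -qE cV -mulnA -expnD.
  rewrite (leq_trans (leq_mul b4 (leqnn _))) -?expnS ?leq_exp2l //; clear -u0; lia.
- rewrite -qE cV /q -expnM -expnD.
  have := card_quads (u * 3) b1; rewrite expnM -/n => hq.
  apply: leq_trans (leq_mul (leqnn 4) hq) _.
  have -> : 9 * u + (3 * u + 2) * 3 = 6 * (u * 3) + 3 + 3 by clear; lia.
  rewrite (expnD _ (6 * (u * 3) + 3)); set B := b ^ (6 * (u * 3) + 3).
  have -> : 4 * (64 * (u * 3) * B) = B * (768 * u) by clear; lia.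
  rewrite leq_mul2l; apply/orP; right.
  have bb : b <= b ^ 3 by rewrite -{1}(expn1 b) leq_exp2l.
  by apply: leq_trans bb; apply: leq_trans b1000; clear; lia.
- by rewrite -qE.
move=> S [s1 s2 s3]; exists S; split=> // I IS gI.
rewrite ltnNge; apply/negP => mI.
have [J JI Jm] : exists2 J : {set grid n}, J \subset I & #|J| = m.
  have : 0 < #|[set B : {set grid n} | B \subset I & #|B| == m]|.
    by rewrite cards_draws bin_gt0.
  by rewrite card_gt0 => /set0Pn[J]; rewrite inE => /andP[JI /eqP Jm]; exists J.
have /s3/negP[] : J \in F; last by rewrite (subset_trans JI).
rewrite inE Jm eqxx andbT; exact: gen_posS JI gI.
Qed.

(** * Projection to the plane *)

Lemma In_mem (T : eqType) (x : T) (s : seq T) : In x s <-> x \in s.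
Proof.
elim: s => [|y s IH] //=; rewrite inE; split=> [[->|/IH->]|/orP[/eqP->|/IH]];
  rewrite ?eqxx ?orbT; auto.
Qed.

Lemma NoDup_uniq (T : eqType) (s : seq T) : reflect (NoDup s) (uniq s).
Proof.
elim: s => [|x s IH] /=; first by do 2 constructor.
apply: (iffP andP) => [[xs /IH us]|h].
  by constructor=> // /In_mem; apply/negP.
by inversion h; subst; split; [apply/negP => /In_mem|apply/IH].
Qed.

Section Projection.
Variable n : nat.
Implicit Types p q r : grid n.

Definition radix : Z := (4 * (Z.of_nat n * Z.of_nat n) + 1)%Z.

(* The kernel of [(x, y, z) |-> (M x - y, M y - z)] is spanned by [(1, M, M^2)]; a minor
   of the images of [u] and [w] is the radix-[M] number with digits [u * w]. *)
Definition proj p : point :=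
  (IZR (radix * cx p - cy p), IZR (radix * cy p - cz p)).

Lemma proj_inj p q : proj p = proj q -> p = q.
Proof.
case=> /eq_IZR e1 /eq_IZR e2.
have [d1 d2 d3] := coord_diff_lt q p.
have n0 : (0 < Z.of_nat n)%Z by lia.
have Mn : (Z.of_nat n < radix)%Z by rewrite /radix; nia.
have [||||a1 [a2 _]] := @radix_zero radix (- (cy p - cy q)) (cx p - cx q) 0; try lia.
have [||||a3 [a4 _]] := @radix_zero radix (- (cz p - cz q)) (cy p - cy q) 0; try lia.
move: a2 a3 a4; rewrite /cx /cy /cz; case: p q {e1 e2 d1 d2 d3 a1} => [[x y] z] [[x' y'] z'] /=.
by move=> h1 h2 h3; congr (_, _, _); apply: val_inj; rewrite /=; lia.
Qed.

Lemma proj_collP p q r :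
  zero_det (proj p) (proj q) (proj r) <-> coll p q r.
Proof.
rewrite /zero_det /= -!minus_IZR -!mult_IZR.
have [u1 u2 u3] := coord_diff_lt p q; have [w1 w2 w3] := coord_diff_lt p r.
rewrite /coll.
set a1 := (cx q - cx p)%Z in u1 *; set a2 := (cy q - cy p)%Z in u2 *.
set a3 := (cz q - cz p)%Z in u3 *; set b1 := (cx r - cx p)%Z in w1 *.
set b2 := (cy r - cy p)%Z in w2 *; set b3 := (cz r - cz p)%Z in w3 *.
have -> : (radix * cx q - cy q - (radix * cx p - cy p) = radix * a1 - a2)%Z by lia.
have -> : (radix * cy q - cz q - (radix * cy p - cz p) = radix * a2 - a3)%Z by lia.
have -> : (radix * cx r - cy r - (radix * cx p - cy p) = radix * b1 - b2)%Z by lia.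
have -> : (radix * cy r - cz r - (radix * cy p - cz p) = radix * b2 - b3)%Z by lia.
clearbody a1 a2 a3 b1 b2 b3.
(* Each digit is a minor with entries below [n] in absolute value, hence at most 2n^2, which is less
   than [radix]. *)
have minor c d c' d' : (Z.abs c < Z.of_nat n -> Z.abs d < Z.of_nat n ->
    Z.abs c' < Z.of_nat n -> Z.abs d' < Z.of_nat n ->
    Z.abs (c * d' - d * c') < radix)%Z.
  rewrite /radix; move: (Z.of_nat n) => m h1 h2 h3 h4.
  have mul x y : (Z.abs x < m -> Z.abs y < m -> Z.abs x * Z.abs y <= m * m)%Z.
    by move=> hx hy; apply: Z.mul_le_mono_nonneg; clear -hx hy; lia.
  have := Z.abs_triangle (c * d') (- (d * c')); rewrite Z.abs_opp !Z.abs_mul.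
  by have := mul _ _ h1 h4; have := mul _ _ h2 h3; clear; lia.
split=> [/eq_IZR h|/and3P[/Z.eqb_spec h1 /Z.eqb_spec h2 /Z.eqb_spec h3]]; last first.
  congr IZR.
  transitivity (radix * radix * (a1 * b2) - radix * (a1 * b3) - radix * (a2 * b2) + a2 * b3)%Z.
    by lia.
  by rewrite h1 h2 h3; lia.
have [||||h1 [h2 h3]] := @radix_zero radix (a2 * b3 - a3 * b2)
  (a3 * b1 - a1 * b3) (a1 * b2 - a2 * b1); try exact: minor; first by lia.
by apply/and3P; split; apply/Z.eqb_spec; lia.
Qed.

Lemma proj_no_four (S : {set grid n}) :
  (forall x, x \in quads n -> ~~ ([set x.1.1.1; x.1.1.2; x.1.2; x.2] \subset S)) ->
  no_four_on_a_line (List.map proj (enum S)).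
Proof.
move=> hS p' q' r' s' /in_map_iff[p [<- /In_mem pS]] /in_map_iff[q [<- /In_mem qS]].
move=> /in_map_iff[r [<- /In_mem rS]] /in_map_iff[s [<- /In_mem sS]].
rewrite !mem_enum in pS qS rS sS.
have ne x y : proj x <> proj y -> x != y by move=> h; apply/eqP => e; rewrite e in h.
move=> /ne pq /ne pr /ne ps /ne qr /ne qs /ne rs [a [b [c [hl [hp [hq [hr hs]]]]]]].
have /proj_collP cr := collinear_det _ _ _ _ _ _ hl hp hq hr.
have /proj_collP cs := collinear_det _ _ _ _ _ _ hl hp hq hs.
have /hS/negP[] : (p, q, r, s) \in quads n.
  by rewrite inE cr cs /= !inE !negb_or pq pr ps qr qs rs.
by rewrite /= !subUset !sub1set pS qS rS sS.
Qed.

Lemma proj_gen_pos (J : seq (grid n)) :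
  general_position (List.map proj J) -> gen_pos [set p in J].
Proof.
move=> gJ; apply/forall_inP => p; rewrite inE => pJ; apply/forall_inP => q.
rewrite inE => qJ; apply/forall_inP => r; rewrite inE => rJ; apply/implyP.
rewrite /= !inE negb_or andbT => /andP[/andP[pq pr] qr]; apply/negP => /proj_collP h.
have ne x y : x != y -> proj x <> proj y by move=> /eqP xy /proj_inj.
have im x : x \in J -> In (proj x) (List.map proj J) by move=> /In_mem; apply: in_map.
apply: (gJ (proj p) (proj q) (proj r) (im _ pJ) (im _ qJ) (im _ rJ)
  (ne _ _ pq) (ne _ _ pr) (ne _ _ qr)).
exact: det_collinear _ _ _ (ne _ _ pq) h.
Qed.

End Projection.

Definition base_bound (u : nat) : nat := (9 * u + 1) * (2 * (1000 * 9 * u)) + 3 * u + 3.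

Lemma expn_pow (b k : nat) : b ^ k = Nat.pow b k.
Proof. by elim: k => // k IH; rewrite expnS IH. Qed.

Lemma planar_no_four (u b : nat) : (0 < u)%coq_nat -> (base_bound u <= b)%coq_nat ->
  exists L : list point, NoDup L /\ (Nat.pow b (6 * u - 3) <= length L)%coq_nat /\
    no_four_on_a_line L /\
    forall T, subset_of T L -> general_position T ->
      (length T <= Nat.pow b (5 * u + 4))%coq_nat.
Proof.
move=> /ltP u0 /leP hb; have [S [s1 s2 s3]] := grid_no_four_collinear u0 hb.
exists (List.map (@proj _) (enum S)); split; [|split; [|split]].
- apply: FinFun.Injective_map_NoDup; first by move=> p q; apply: proj_inj.
  by apply/NoDup_uniq; apply: enum_uniq.
- by rewrite length_map -expn_pow -[length _]/(size _) -cardE; apply/leP.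
- exact: proj_no_four.
move=> T [Tnd /incl_map_preimage[J [TJ JS]]] gT; subst T.
rewrite length_map -expn_pow -[length _]/(size _); apply/leP.
have uJ : uniq J by apply/NoDup_uniq; apply: NoDup_map_inv Tnd.
rewrite -(card_uniqP uJ) -cardsE; apply: ltnW; apply: s3; last exact: proj_gen_pos.
by apply/subsetP => x; rewrite inE => /In_mem/JS/In_mem; rewrite mem_enum.
Qed.

End GridPoints.

(* alpha(n) <= n^(5/6 + o(1)): for every delta > 0, for all sufficiently large n,
   there is an n-point set S with no four points on a line and alpha(S) <= n^(5/6+delta)
   (which is exactly alpha(n) = min alpha(S) <= n^(5/6+delta)). *)
Theorem theorem2p1 :
  forall delta : R, 0 < delta ->
  exists N : nat, forall n : nat, (N <= n)%nat ->
    exists S : list point,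
      finite_set S /\ length S = n /\ no_four_on_a_line S /\
      alpha_le S (Rpower (INR n) (5 / 6 + delta)).
Proof.
exact (alpha_le_of_powers GridPoints.base_bound GridPoints.planar_no_four).
Qed.
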